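(* Fix $\alpha \in (0,1)$. Then there exist constants $c, C > 0$ and $m_0 \in \mathbb{N}$, depending only on $\alpha$, such that for every $m \ge m_0$ that is a power of $2$ and every integer $n$ with $\frac{\alpha}{2} m^2 < n \le \alpha m^2$, the $L^\infty$ intrinsic diameter of the labeled configuration space $\widetilde{\mathrm{sq}}(n;m)$ lies between $c\,m$ and $C\,m$, and the $L^\infty$ extrinsic diameter of $\widetilde{\mathrm{sq}}(n;m)$ also lies between $c\,m$ and $C\,m$. (That is, the $L^\infty$ intrinsic diameter grows as $\Theta(m)$, matching the $L^\infty$ extrinsic diameter up to a constant factor depending only on $\alpha$.)
   Context: $\widetilde{\mathrm{sq}}(n;m)$ is the set of all ways to place $n$ pieces, numbered $1,\dots,n$, in distinct positions (cells) of the $m \times m$ square grid. Two cells are adjacent if they share an edge. A hole is an unoccupied cell. $L^\infty$ intrinsic metric: two configurations are adjacent (at distance $1$) if one is obtained from the other by simultaneously moving any number of pieces, each into a hole adjacent to it. Each target cell must be a hole in the initial configuration (moving into a cell that is being simultaneously vacated is not permitted), and the result must again have pieces in distinct cells. The $L^\infty$ intrinsic metric is the graph metric generated by this adjacency relation (the distance is the least number of time steps, and is $\infty$ if there is no path). $L^\infty$ extrinsic metric: the distance between two configurations is the maximum over all pieces of the distance along the grid (graph distance in the grid) between the positions of that piece in the two configurations. The diameter with respect to a metric is the supremum of distances between pairs of configurations. *)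

(* Defs.v *)
From HB Require Import structures.
From mathcomp Require Import all_boot all_order all_algebra.
From mathcomp Require Import boolp classical_sets reals constructive_ereal ereal.

Set Implicit Arguments.
Unset Strict Implicit.
Unset Printing Implicit Defensive.

Import Order.TTheory GRing.Theory Num.Theory.

Local Open Scope classical_set_scope.
Local Open Scope ring_scope.

(* [ereal_inf set0 = +oo], so vertices not joined by a path are at infinite
   distance. *)
Definition graph_dist (R : realType) (T : eqType) (e : rel T)
    (x y : T) : \bar R :=
  ereal_inf [set ((size p)%:R)%:E | p in
               [set p : seq T | path e x p && (last x p == y)]].

Definition diameter (R : realType) (T : Type)
    (d : T -> T -> \bar R) : \bar R :=
  ereal_sup [set d xy.1 xy.2 | xy in [set: T * T]].

Definition cell (m : nat) : Type := ('I_m * 'I_m)%type.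

Definition consecutive (m : nat) : rel 'I_m :=
  fun i j => (i.+1 == j :> nat) || (j.+1 == i :> nat).

Definition cell_adj (m : nat) : rel (cell m) := fun a b =>
  ((a.1 == b.1) && consecutive a.2 b.2) ||
  ((a.2 == b.2) && consecutive a.1 b.1).

(* Pieces are numbered from 0 instead of from 1. *)
Definition sq (n m : nat) : Type :=
  {f : {ffun 'I_n -> 'I_m * 'I_m} | injectiveb f}.

Definition pos (n m : nat) (f : sq n m) (i : 'I_n) : cell m := val f i.

Definition is_hole (n m : nat) (f : sq n m) (a : cell m) : bool :=
  [forall j : 'I_n, pos f j != a].

(* Holes are those of the initial configuration [f]; that no two pieces move
   into the same hole is enforced by [g] being a configuration.  The set of
   moving pieces may be empty: the resulting loops do not affect distances. *)
Definition sq_move (n m : nat) : rel (sq n m) := fun f g =>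
  [forall i : 'I_n, (pos g i == pos f i) ||
                    (cell_adj (pos f i) (pos g i) && is_hole f (pos g i))].

Definition Linfty_intrinsic (R : realType) (n m : nat) (f g : sq n m) : \bar R :=
  graph_dist R (@sq_move n m) f g.

Definition Linfty_extrinsic (R : realType) (n m : nat) (f g : sq n m) : \bar R :=
  \big[maxe/0%E]_(i < n) graph_dist R (@cell_adj m) (pos f i) (pos g i).

(* Main.v *)
Require Import Defs.
From mathcomp Require Import boolp classical_sets reals constructive_ereal ereal.
From mathcomp Require Import all_boot all_fingroup all_order all_algebra zify.

(** The lower bounds come from a single piece that has to go from the first row
    to the last one, and the upper bound on the extrinsic diameter from the fact
    that two cells are at most [2 * m] apart. The content of the theorem is that
    every configuration reaches every other one in [O(m)] steps
    ([config_route]).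

    If two adjacent pieces could be exchanged in one step, this would be a
    classical routing argument. Every permutation of a [p * q] grid is a product
    of [O(p + q)] matchings of adjacent cells ([grid_routing]): permute inside
    the columns, then inside the rows, then inside the columns again. The first
    phase has to put into each row tokens with pairwise different destination
    columns; this is an edge colouring of a regular bipartite multigraph and
    follows from Hall's theorem ([hall_marriage], [regular_edge_coloring]).
    Inside a line, odd-even transposition sort takes linear time
    ([sort_state_sorted]).

    Pieces only move into holes, and two facts make up for that. First, as long
    as only the set of holes matters, the exchanges of two pieces can simply be
    skipped ([slide_matching]), so that a set of holes can be carried onto any
    other set of the same size in [O(m)] steps. A fixed proportion of the cells
    is empty; hence, for a suitable constant [d], the holes can be made to fill
    one column out of [d + 1], any further holes being treated like pieces.
    Second, two adjacent pieces can then be exchanged in bounded time: the holes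
    of two neighbouring rows are brought next to them, the pieces circulate
    around a square that contains these holes, and the holes go back
    ([square_swap], [conjugate_swap]). Exchanges that are far apart run in
    parallel ([legal_parallel]), so that a matching costs a bounded number of
    steps provided that its pairs lie in one congruence class of places
    ([simulates_round]). This is why the rounds of [grid_routing] are required
    to be sparse.

    Since moves are reversible, one goes from [f] to [g] by carrying the holes
    of [f] to the empty columns, permuting the pieces, and running backwards the
    moves that carry the holes of [g] to the empty columns ([route_pieces]). *)

Set Implicit Arguments.
Unset Strict Implicit.
Unset Printing Implicit Defensive.

(** * Hall's theorem and edge colouring *)

Section Hall.
Variables (A B : finType).

Definition hall_condition (N : A -> {set B}) :=
  [forall S : {set A}, #|S| <= #|\bigcup_(a in S) N a|].

(** If both deletions broke the condition, two sets [T1] and [T2] that avoid [a]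
    would have too few neighbours together with [a]. Counting the neighbours of
    [a |: (T1 :|: T2)] and of [T1 :&: T2] then gives a contradiction, because the
    number of neighbours is a submodular function. *)
Lemma hall_shrink (N : A -> {set B}) a x y :
  hall_condition N -> x \in N a -> y \in N a -> x != y ->
  hall_condition (fun c => if c == a then N a :\ x else N c) ||
  hall_condition (fun c => if c == a then N a :\ y else N c).
Proof.
move=> /forallP hN xa ya nxy; rewrite -[_ || _]negbK negb_or !negb_forall.
apply/negP => /andP[/existsP[S1 h1] /existsP[S2 h2]].
have key z (S : {set A}) : z \in N a ->
    ~~ (#|S| <= #|\bigcup_(c in S) (if c == a then N a :\ z else N c)|) ->
    #|\bigcup_(c in S :\ a) N c :|: N a :\ z| <= #|S :\ a|.
  move=> za; rewrite -ltnNge => hS.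
  have aS : a \in S.
    apply: contraLR hS => naS; rewrite -leqNgt.
    apply: leq_trans (hN S) _; apply: eq_leq; apply/esym.
    congr #|pred_of_set _|; apply: eq_bigr => c cS.
    by case: eqP => // ec; rewrite -ec cS in naS.
  move: hS; rewrite (cardsD1 a S) aS add1n ltnS.
  apply: leq_trans; rewrite [in X in _ <= X](big_setD1 a) //= eqxx setUC.
  apply: subset_leq_card; apply: setUS; apply/bigcupsP => c cS.
  apply: (bigcup_max c) => //; case: eqP => // ec.
  by rewrite ec setD11 in cS.
have := leq_add (key x S1 xa h1) (key y S2 ya h2).
set T1 := S1 :\ a; set T2 := S2 :\ a.
rewrite -(cardsUI T1 T2) -cardsUI leqNgt => /negP; apply.
have aT : a \notin T1 :|: T2 by rewrite !inE !eqxx.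
rewrite -addSn leq_add //.
  have := hN (a |: (T1 :|: T2)); rewrite cardsU1 aT add1n => /leq_trans; apply.
  apply: subset_leq_card; apply/bigcupsP => c; rewrite in_setU1.
  case/orP=> [/eqP ->|].
    apply/subsetP => z za; rewrite !inE za !andbT.
    case: (eqVneq z x) => [->|]; last by rewrite !orbT.
    by rewrite nxy !orbT.
  rewrite in_setU => /orP[] cT; apply/subsetP => z za; rewrite !in_setU.
    by rewrite (_ : z \in \bigcup_(c in T1) N c) //; apply/bigcupP; exists c.
  by rewrite (_ : z \in \bigcup_(c in T2) N c) ?orbT //; apply/bigcupP; exists c.
apply: leq_trans (hN _) _; apply: subset_leq_card; apply/bigcupsP => c.
rewrite in_setI => /andP[c1 c2]; apply/subsetP => z za; rewrite in_setI !in_setU.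
by apply/andP; split; apply/orP; left; apply/bigcupP; exists c.
Qed.


(** Neighbourhoods are shrunk until all of them are singletons; Hall's condition
    for pairs of elements then says that the singletons are distinct. *)
Lemma hall_marriage (N : A -> {set B}) :
  hall_condition N -> exists f : A -> B, injective f /\ forall a, f a \in N a.
Proof.
have [n le_n] := ubnP (\sum_a #|N a|).
elim: n N le_n => // n IH N le_n hN.
have [/existsP[a big]|small] := boolP [exists a, 1 < #|N a|].
  have [x [y [xa ya nxy]]] : exists x y, [/\ x \in N a, y \in N a & x != y].
    have /card_gt0P[x xa] : 0 < #|N a| by apply: ltnW.
    move: big; rewrite (cardsD1 x) xa add1n ltnS => /card_gt0P[y].
    by rewrite !inE => /andP[nyx ya]; exists x, y; rewrite eq_sym.
  have shrink z : z \in N a ->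
      hall_condition (fun c => if c == a then N a :\ z else N c) ->
      exists f : A -> B, injective f /\ forall a, f a \in N a.
    move=> za hz; have [|f [f_inj fN]] := IH _ _ hz.
      rewrite -ltnS; apply: leq_trans le_n; rewrite ltnS.
      rewrite (bigD1 a) //= [X in _ < X](bigD1 a) //= eqxx.
      rewrite [in X in _ < X](cardsD1 z) za -addnA add1n ltnS leq_add2l.
      by apply: leq_sum => c /negPf ->.
    exists f; split=> // c; have := fN c; case: eqP => [->|//].
    by rewrite !inE => /andP[].
  by case/orP: (hall_shrink hN xa ya nxy) => /shrink; apply.
have one a : exists b, N a = [set b].
  apply/cards1P; rewrite eqn_leq leqNgt; apply/andP; split.
    by apply: contra small => h; apply/existsP; exists a.
  by have /forallP/(_ [set a]) := hN; rewrite big_set1 cards1.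
have [f fE] := fin_all_exists one.
exists f; split=> [a a' eqf|a]; last by rewrite fE set11.
apply: contraTeq hN => naa'; rewrite negb_forall; apply/existsP.
exists [set a; a'].
by rewrite cards2 naa' bigcup_setU !big_set1 !fE eqf setUid cards1.
Qed.

End Hall.

(** A perfect matching exists by Hall's theorem, since a set [S] of left
    vertices emits [k * #|S|] edges while its neighbourhood absorbs at most
    [k] per vertex; removing that matching leaves a multigraph of degree one
    less, which gives the colours one at a time. *)
Lemma regular_edge_coloring (E Q : finType) (s d : E -> Q) (k : nat)
    (X : {set E}) :
  (forall y, #|[set e in X | s e == y]| = k) ->
  (forall y, #|[set e in X | d e == y]| = k) ->
  exists r : E -> nat, [/\ forall e, e \in X -> r e < k,
    {in X &, forall e e', r e = r e' -> s e = s e' -> e = e'} &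
    {in X &, forall e e', r e = r e' -> d e = d e' -> e = e'}].
Proof.
elim: k X => [|k IH] X sX dX.
  have X0 e : e \in X = false.
    apply/negbTE/negP => eX; have /eqP := sX (s e).
    by rewrite cards_eq0 => /eqP/setP/(_ e); rewrite !inE eX eqxx.
  by exists (fun=> 0); split=> [e|e e'|e e']; rewrite ?X0.
have count (g : E -> Q) (S : {set Q}) :
    (forall y, #|[set e in X | g e == y]| = k.+1) ->
    #|[set e in X | g e \in S]| = #|S| * k.+1.
  move=> gX; rewrite -sum1_card (partition_big g (mem S)) /=; last first.
    by move=> e; rewrite inE => /andP[].
  rewrite -sum_nat_const; apply: eq_bigr => y yS; rewrite -(gX y) -sum1_card.
  by apply: eq_bigl => e; rewrite !inE; case: eqP => [->|]; rewrite ?andbF ?yS ?andbT.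
pose N y := [set d e | e in X & s e == y].
have hN : hall_condition N.
  apply/forallP => S; rewrite -(leq_pmul2r (ltn0Sn k)) -(count s S sX) -(count d _ dX).
  apply: subset_leq_card; apply/subsetP => e; rewrite !inE => /andP[eX eS].
  rewrite eX; apply/bigcupP; exists (s e) => //.
  by apply/imsetP; exists e => //; rewrite inE eX eqxx.
have [f [f_inj fN]] := hall_marriage hN.
have fe y : exists e, [/\ e \in X, s e = y & d e = f y].
  have /imsetP[e] := fN y; rewrite inE => /andP[eX /eqP se] de.
  by exists e.
have {fe}[h hP] := fin_all_exists fe.
have h_inj : injective h.
  by move=> y y' eh; have [_ <- _] := hP y; have [_ <- _] := hP y'; rewrite eh.
pose M := [set h y | y : Q].
(* Each vertex loses exactly the edge that the matching assigns to it. *)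
have remove (g : E -> Q) (v : Q -> Q) : injective v -> (forall y, g (h y) = v y) ->
    (forall y, #|[set e in X | g e == y]| = k.+1) ->
    forall y, #|[set e in X :\: M | g e == y]| = k.
  move=> v_inj gh gX y; have [v' vK v'K] := injF_bij v_inj.
  have := gX y; rewrite (cardsD1 (h (v' y))) !inE.
  have [hX _ _] := hP (v' y); rewrite hX gh v'K eqxx => -[<-].
  apply: eq_card => e; rewrite !inE.
  case: (eqVneq (g e) y) => [gey|]; rewrite ?andbF // !andbT.
  congr (~~ _ && _); apply/imsetP/eqP => [[z _ ez]|->]; last by exists (v' y).
  by rewrite ez; congr h; rewrite -gey ez gh vK.
have [||r [rk rs rd]] := IH (X :\: M).
- by apply: (remove s id) => // y; have [] := hP y.
- by apply: (remove d f) => // y; have [] := hP y.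
pose r' e := if e \in M then k else r e.
have XM e : e \in X -> e \notin M -> e \in X :\: M by rewrite !inE => -> ->.
exists r'; split=> [e eX|e e' eX e'X|e e' eX e'X]; rewrite /r'.
- by case: ifPn => // eM; apply: ltnW; rewrite ltnS; apply/rk/XM.
- case: ifPn => eM; case: ifPn => e'M.
  + case/imsetP: eM => y _ ->; case/imsetP: e'M => y' _ -> _.
    by have [_ -> _] := hP y; have [_ -> _] := hP y' => ->.
  + by move=> ek; have := rk e' (XM _ e'X e'M); rewrite -ek ltnn.
  + by move=> ek; have := rk e (XM _ eX eM); rewrite ek ltnn.
  + by move=> h1 h2; apply: rs => //; apply: XM.
- case: ifPn => eM; case: ifPn => e'M.
  + case/imsetP: eM => y _ ->; case/imsetP: e'M => y' _ -> _.
    by have [_ _ ->] := hP y; have [_ _ ->] := hP y' => /f_inj ->.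
  + by move=> ek; have := rk e' (XM _ e'X e'M); rewrite -ek ltnn.
  + by move=> ek; have := rk e (XM _ eX eM); rewrite ek ltnn.
  + by move=> h1 h2; apply: rd => //; apply: XM.
Qed.

(** * Sorting on a line *)

Section LineSort.
Variables (L M : nat).
Hypothesis M_gt1 : 1 < M.
Implicit Types (s : {perm 'I_L}) (i : 'I_L).

(** At either end of the line the neighbour is the position itself, so that
    comparing the two never triggers an exchange. *)
Definition next_ord i : 'I_L := insubd i i.+1.
Definition prev_ord i : 'I_L := insubd i i.-1.

Lemma next_ordE i : next_ord i = (if i.+1 < L then i.+1 else i) :> nat.
Proof. exact: val_insubd. Qed.

Lemma prev_ordE i : prev_ord i = i.-1 :> nat.
Proof. by rewrite val_insubd (leq_ltn_trans (leq_pred i)). Qed.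

Lemma modS_neq k e : k %% M = e -> (k.+1 %% M == e) = false.
Proof.
move=> <-; rewrite -addn1 -[X in _ == X %% M]addn0 eqn_modDl mod0n.
by rewrite modn_small.
Qed.

(** One round of transposition sort, where only the pairs [(k, k.+1)] with
    [k = e %[mod M]] are compared. For [M = 2] this is odd-even transposition
    sort; a large [M] keeps the simultaneous exchanges far apart. *)
Definition compare_swap_fun (e : nat) s i : 'I_L :=
  if (i %% M == e) && (s (next_ord i) < s i) then next_ord i else
  if (prev_ord i %% M == e) && (s i < s (prev_ord i)) then prev_ord i else i.

Variant compare_swap_spec e s i : 'I_L -> Prop :=
  | CompareSwapUp i' of i' = i.+1 :> nat & i %% M = e & s i' < s i :
      compare_swap_spec e s i i'
  | CompareSwapDown i' of i = i'.+1 :> nat & i' %% M = e & s i < s i' :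
      compare_swap_spec e s i i'
  | CompareSwapNone of (forall i', i' = i.+1 :> nat -> i %% M = e -> s i < s i')
      & (forall i', i = i'.+1 :> nat -> i' %% M = e -> s i' < s i) :
      compare_swap_spec e s i i.

Lemma compare_swapP e s i : compare_swap_spec e s i (compare_swap_fun e s i).
Proof.
rewrite /compare_swap_fun; case: ifPn => [/andP[/eqP ie lt_s]|up].
  constructor=> //; have := next_ordE i; case: ltnP => // _ /ord_inj eqi.
  by rewrite eqi ltnn in lt_s.
case: ifPn => [/andP[/eqP ie lt_s]|dn].
  apply: CompareSwapDown => //; rewrite prev_ordE; have [i0|/prednK->//] := posnP i.
  by rewrite (_ : prev_ord i = i) ?ltnn // in lt_s; apply: ord_inj; rewrite prev_ordE i0.
have neq_s i' : i' != i -> s i' != s i :> nat.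
  by apply: contra => /eqP/ord_inj/perm_inj ->.
constructor=> i' ei' ie.
  move: up; rewrite ie eqxx -leqNgt leq_eqVlt.
  have -> : next_ord i = i' by apply: ord_inj; rewrite next_ordE -ei' ltn_ord.
  rewrite eq_sym (negPf (neq_s _ _)) //.
  by apply/eqP => e'; rewrite e' in ei'; lia.
move: dn; have -> : prev_ord i = i' by apply: ord_inj; rewrite prev_ordE ei'.
rewrite ie eqxx -leqNgt leq_eqVlt (negPf (neq_s _ _)) //.
by apply/eqP => e'; rewrite e' in ei'; lia.
Qed.

Lemma compare_swapK e s : involutive (compare_swap_fun e s).
Proof.
move=> i; have spec := compare_swapP e s i.
have := compare_swapP e s (compare_swap_fun e s i).
case: spec => [i' e1 e2 lt1|i' e1 e2 lt1|h1 h2].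
- case=> [i'' e3 e4 lt2|i'' e3 e4 lt2|h1 h2].
  + by have := modS_neq e2; rewrite -e1 e4 eqxx.
  + by apply: ord_inj; lia.
  + by have := h2 i e1 e2; rewrite ltnNge ltnW.
- case=> [i'' e3 e4 lt2|i'' e3 e4 lt2|h1 h2].
  + by apply: ord_inj; lia.
  + by have := modS_neq e4; rewrite -e3 e2 eqxx.
  + by have := h1 i e1 e2; rewrite ltnNge ltnW.
- by case=> [i'' e3 e4 lt2|i'' e3 e4 lt2|//];
   [have := h1 i'' e3 e4 | have := h2 i'' e3 e4]; rewrite ltnNge ltnW.
Qed.

Definition compare_swap e s : {perm 'I_L} :=
  perm (can_inj (compare_swapK e s)).

(** Comparing all destinations with a threshold [th] turns the line into a 0-1
    sequence, which evolves under the rounds without reference to the other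
    thresholds; this function is its height function. *)
Definition high_count s th q := \sum_(i < L | q <= i) (th <= s i : nat).

Lemma high_countD s th q (lt_q : q < L) :
  high_count s th q = (th <= s (Ordinal lt_q)) + high_count s th q.+1.
Proof.
rewrite /high_count (bigD1 (Ordinal lt_q)) //=; congr (_ + _).
by apply: eq_bigl => i; rewrite -val_eqE /= [RHS]ltn_neqAle eq_sym andbC.
Qed.

Lemma high_count_stable e s th q :
  (forall j, q = j.+1 -> j %% M != e) ->
  high_count (compare_swap e s * s)%g th q = high_count s th q.
Proof.
move=> hq; rewrite /high_count [RHS](reindex_inj (@perm_inj _ (compare_swap e s))).
apply: eq_big => [i|i _]; last by rewrite permM.
rewrite permE; case: compare_swapP => // i' e1 e2 _; rewrite e1.
  case: q hq => // j /(_ j erefl) je.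
  by rewrite [RHS]leq_eqVlt eqSS; case: eqP => // ej; rewrite ej e2 eqxx in je.
case: q hq => // j /(_ j erefl) je.
by rewrite [LHS]leq_eqVlt eqSS; case: eqP => // ej; rewrite ej e2 eqxx in je.
Qed.

(** A high token crosses the boundary between [j] and [j.+1] unless position [j]
    is low or position [j.+1] is high already. In terms of heights, the new value
    is the minimum of the left neighbour and of the right neighbour plus one. *)
Lemma high_count_swap e s th j : j %% M = e -> j.+1 < L ->
  minn (high_count s th j) (high_count s th j.+2).+1
    <= high_count (compare_swap e s * s)%g th j.+1.
Proof.
move=> je ltj; have ltj' := ltnW ltj.
rewrite (high_countD _ _ ltj') !(high_countD _ _ ltj) high_count_stable; last first.
  by move=> _ [<-]; rewrite modS_neq.
rewrite permM permE.
case: compare_swapP => [i' /= _ e2 _|i' /= [/esym e1] _ lt1|_ /(_ (Ordinal ltj') erefl je)].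
- by have := modS_neq je; rewrite e2 eqxx.
- have -> : Ordinal ltj' = i' by apply: ord_inj.
  by case: (leqP th (s i')); case: (leqP th (s (Ordinal ltj))); lia.
- case: (leqP th (s (Ordinal ltj'))); case: (leqP th (s (Ordinal ltj))); lia.
Qed.

Lemma high_count_mono e s th q :
  high_count s th q <= high_count (compare_swap e s * s)%g th q.
Proof.
case: q => [|j]; first by rewrite high_count_stable.
have [je|je] := eqVneq (j %% M) e; last first.
  by rewrite high_count_stable // => _ [<-].
have [ltj|geL] := ltnP j.+1 L.
  apply: leq_trans (high_count_swap s th je ltj).
  rewrite (high_countD _ _ (ltnW ltj)) (high_countD _ _ ltj); lia.
rewrite /high_count big1 // => i lt_i; have := ltn_ord i; lia.
Qed.

Fixpoint sort_state s t :=
  if t is t'.+1 then (compare_swap (t' %% M) (sort_state s t') * sort_state s t')%g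
  else s.

Lemma sort_state_mono s th q t u : t <= u ->
  high_count (sort_state s t) th q <= high_count (sort_state s u) th q.
Proof.
elim: u => [|u IH]; first by rewrite leqn0 => /eqP ->.
rewrite leq_eqVlt => /predU1P[-> //|]; rewrite ltnS => /IH/leq_trans; apply.
exact: high_count_mono.
Qed.

(** Among [M] consecutive rounds one compares the pair [(j, j.+1)], and the
    heights never decrease in the others. *)
Lemma sort_state_sweep s th t j : j.+1 < L ->
  minn (high_count (sort_state s t) th j)
       (high_count (sort_state s t) th j.+2).+1
    <= high_count (sort_state s (t + M)) th j.+1.
Proof.
move=> ltj.
have [v [tv vt jv]] : exists v, [/\ t <= v, v < t + M & j %% M = v %% M].
  exists (t + (j + t * M.-1) %% M); rewrite leq_addr ltn_add2l ltn_mod; split=> //; first lia.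
  rewrite modnDmr (_ : t + _ = t * M + j) ?modnMDl //; case: (M) M_gt1 => // M' _; lia.
apply: leq_trans (sort_state_mono _ _ _ vt) => /=.
apply: leq_trans (high_count_swap _ _ jv ltj).
by rewrite leq_min !geq_min ltnS !sort_state_mono ?orbT.
Qed.

(** The high token number [j] from the right is held up by the preceding ones
    for at most [2 * j] sweeps, and then advances by one position per sweep. *)
Lemma high_count_sweeps s th u j q :
  q + j.*2 <= u -> j < high_count s th 0 -> q + j < L ->
  j < high_count (sort_state s (u * M)) th q.
Proof.
have total t : high_count (sort_state s t) th 0 = high_count s th 0.
  by elim: t => //= t <-; apply: high_count_stable.
elim: u j q => [|u IH] j q le_u jk ltL.
  by rewrite (_ : q = 0) ?total //; lia.
rewrite mulSn addnC; case: q le_u ltL => [|q] le_u ltL; first by rewrite total.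
apply: leq_trans (sort_state_sweep _ _ _ _); last lia.
rewrite leq_min ltnS IH //=; try lia.
by case: j le_u jk ltL => // j le_u jk ltL; apply: IH; lia.
Qed.

Lemma perm_ge_id s : (forall i, i <= s i) -> s = 1%g.
Proof.
move=> ge_s; apply/permP => i; rewrite perm1; apply/ord_inj/esym/eqP.
have [_] := leqif_sum (fun (i : 'I_L) (_ : true) => leqif_eq (ge_s i)).
rewrite -(reindex_inj (@perm_inj _ s) (P := fun=> true) (F := fun i => nat_of_ord i)) /=.
by rewrite eqxx => /esym/forall_inP/(_ i erefl).
Qed.

(** After [2 * L] sweeps, for every [i], the positions from [i] on hold tokens with
    destinations at least [i]. So no token is to the right of its destination,
    which forces the identity. *)
Lemma sort_state_sorted s : sort_state s (L.*2 * M) = 1%g.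
Proof.
apply: perm_ge_id => i; set s' := sort_state _ _.
have total : high_count s i 0 = L - i.
  rewrite /high_count -(reindex_inj (@perm_inj _ s) (P := fun=> true)
    (F := fun k : 'I_L => (i <= k : nat))) /=.
  rewrite -big_mkcond /= -(big_geq_mkord i L predT (fun=> 1)).
  by rewrite sum_nat_const_nat muln1.
have ltiL := ltn_ord i.
have : L - i.+1 < high_count s' i i by apply: high_count_sweeps; lia.
rewrite (high_countD _ _ ltiL) (_ : Ordinal ltiL = i); last exact: ord_inj.
case: (leqP i (s' i)) => // _; rewrite add0n ltnNge.
rewrite {1}/high_count (leq_trans (leq_sum _ (fun k _ => leq_b1 _))) //.
by rewrite -(big_geq_mkord i.+1 L predT (fun=> 1)) sum_nat_const_nat muln1.
Qed.
End LineSort.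

(** * Routing on a grid *)

Section SortRounds.
Local Open Scope group_scope.
Variables (L M : nat).
Hypothesis M_gt1 : 1 < M.

Definition sort_round (s : {perm 'I_L}) t : {perm 'I_L} :=
  compare_swap M_gt1 (t %% M) (sort_state M_gt1 s t).

Lemma sort_roundK s t : involutive (sort_round s t).
Proof. by move=> i; rewrite /sort_round !permE (compare_swapK M_gt1). Qed.

Lemma sort_roundP s t i : sort_round s t i = i \/
  consecutive i (sort_round s t i) /\ minn i (sort_round s t i) %% M = t %% M.
Proof.
rewrite /sort_round !permE; case: (compare_swapP M_gt1) => [i' e1 e2 _|i' e1 e2 _|_ _].
- by right; rewrite /consecutive e1 eqxx (minn_idPl _).
- by right; rewrite /consecutive e1 eqxx orbT (minn_idPr _).
- by left.
Qed.

Lemma prod_sort_rounds s : \prod_(0 <= t < L.*2 * M) sort_round s t = s.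
Proof.
have split_off n : \prod_(0 <= t < n) sort_round s t * sort_state M_gt1 s n = s.
  elim: n => [|n IH]; first by rewrite big_geq // mul1g.
  rewrite big_nat_recr //= -mulgA (mulgA (sort_round _ _)).
  rewrite (_ : sort_round s n * _ = 1) ?mul1g //.
  by apply/permP => i; rewrite permM sort_roundK perm1.
by have := split_off (L.*2 * M)%N; rewrite sort_state_sorted mulg1.
Qed.
End SortRounds.

Section GridRounds.
Local Open Scope group_scope.
Variables (M p q : nat).
Local Notation V := ('I_p * 'I_q)%type.
Implicit Types (r s : {perm V}) (c : V).

(** A sparse round: it exchanges vertically adjacent cells, and the upper cells
    of these pairs are congruent modulo [M] in both coordinates. *)
Definition column_round e z r := forall c, r c = c \/
  [/\ (r c).2 = c.2, consecutive c.1 (r c).1,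
      minn c.1 (r c).1 %% M = e & c.2 %% M = z].

Definition row_round e z r := forall c, r c = c \/
  [/\ (r c).1 = c.1, consecutive c.2 (r c).2,
      minn c.2 (r c).2 %% M = e & c.1 %% M = z].

Definition grid_round r := involutive r /\
  exists e z, column_round e z r \/ row_round e z r.

Definition routed n s := exists l : seq {perm V},
  [/\ size l = n, {in l, forall r, grid_round r} & s = \prod_(r <- l) r].

Lemma routedM n n' s s' : routed n s -> routed n' s' -> routed (n + n') (s * s').
Proof.
move=> [l [<- hl ->]] [l' [<- hl' ->]]; exists (l ++ l').
by rewrite size_cat big_cat; split=> // r; rewrite mem_cat => /orP[/hl|/hl'].
Qed.

Lemma routed_prod k n (F : nat -> {perm V}) : (forall t, routed k (F t)) ->
  routed (n * k) (\prod_(0 <= t < n) F t).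
Proof.
move=> hF; elim: n => [|n IH].
  by exists [::]; rewrite !big_nil.
by rewrite big_nat_recr // mulSn addnC; apply: routedM.
Qed.

Lemma routed_round r : grid_round r -> routed 1 r.
Proof.
move=> hr; exists [:: r]; rewrite big_seq1; split=> // r'.
by rewrite inE => /eqP ->.
Qed.
End GridRounds.

Section ColumnRouting.
Local Open Scope group_scope.
Variables (M p q : nat).
Hypothesis M_gt1 : 1 < M.
Local Notation V := ('I_p * 'I_q)%type.

Definition column_fun (u : 'I_q -> {perm 'I_p}) (c : V) : V := (u c.2 c.1, c.2).

Lemma column_fun_inj u : injective (column_fun u).
Proof. by move=> [i j] [i' j'] [] + eqj; rewrite -eqj => /perm_inj ->. Qed.

Definition column_perm u : {perm V} := perm (@column_fun_inj u).

Lemma column_permE u c : column_perm u c = (u c.2 c.1, c.2).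
Proof. by rewrite permE. Qed.

Lemma column_perm_prod n (F : nat -> 'I_q -> {perm 'I_p}) :
  \prod_(0 <= t < n) column_perm (F t)
  = column_perm (fun j => \prod_(0 <= t < n) F t j).
Proof.
apply/permP; elim: n => [|n IH] [i j]; rewrite column_permE /=.
  by rewrite !big_geq // !perm1.
by rewrite !big_nat_recr //= !permM IH !column_permE.
Qed.

(** The columns of each residue class modulo [M] are sorted in parallel, one
    class after the other. *)
Lemma routed_column_perm u : routed M (M * (p.*2 * M)) (column_perm u).
Proof.
pose u_ (z : nat) (j : 'I_q) := if j %% M == z then u j else 1.
have uE j : \prod_(0 <= z < M) u_ z j = u j.
  have part n : \prod_(0 <= z < n) u_ z j = if j %% M < n then u j else 1.
    elim: n => [|n IH]; first by rewrite big_geq.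
    rewrite big_nat_recr //= IH ltnS (leq_eqVlt (j %% M) n) /u_.
    by case: (ltngtP (j %% M) n); rewrite /= ?mulg1 ?mul1g /=; rewrite ?mulg1 ?mul1g.
  by rewrite part ltn_mod (ltnW M_gt1).
have -> : column_perm u = \prod_(0 <= z < M) column_perm (u_ z).
  by rewrite column_perm_prod; apply/permP => c; rewrite !column_permE uE.
apply: routed_prod => z.
pose r t (j : 'I_q) := if j %% M == z then sort_round M_gt1 (u j) t else 1.
have -> : column_perm (u_ z) = \prod_(0 <= t < p.*2 * M) column_perm (r t).
  rewrite column_perm_prod; apply/permP => c; rewrite !column_permE /u_ /r.
  case: eqP => _; first by rewrite prod_sort_rounds.
  by rewrite big1.
rewrite -[X in routed _ X]muln1; apply: routed_prod => t.
apply: routed_round; split=> [c|].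
  rewrite !column_permE /r /=; case: eqP => _; first by rewrite sort_roundK -surjective_pairing.
  by rewrite !perm1 -surjective_pairing.
exists (t %% M), z; left=> c; rewrite column_permE /r.
case: eqP => [cz|_] /=; last by left; rewrite perm1 -surjective_pairing.
have [->|[h1 h2]] := sort_roundP M_gt1 (u c.2) t c.1.
  by left; rewrite -surjective_pairing.
by right.
Qed.

Lemma column_perm_of (s : {perm V}) : (forall c, (s c).2 = c.2) ->
  exists u, s = column_perm u.
Proof.
move=> hs; have inj j : injective (fun i => (s (i, j)).1).
  move=> i i' eqi; suff /perm_inj[] : s (i, j) = s (i', j) by [].
  by rewrite [LHS]surjective_pairing [RHS]surjective_pairing eqi !hs.
exists (fun j => perm (@inj j)); apply/permP => -[i j].
by rewrite column_permE /= permE {1}[s _]surjective_pairing hs.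
Qed.
End ColumnRouting.

Section Transpose.
Local Open Scope group_scope.
Variables (M p q : nat).

Definition flip_fun (s : {perm 'I_p * 'I_q}) (c : 'I_q * 'I_p) : 'I_q * 'I_p :=
  let d := s (c.2, c.1) in (d.2, d.1).

Lemma flip_fun_inj s : injective (flip_fun s).
Proof.
move=> [i j] [i' j'] [e2 e1]; suff /perm_inj[-> ->] : s (j, i) = s (j', i') by [].
by rewrite (surjective_pairing (s (j, i))) e1 e2 -surjective_pairing.
Qed.

Definition flip_perm s : {perm 'I_q * 'I_p} := perm (@flip_fun_inj s).

Lemma flip_permE s c : flip_perm s c = ((s (c.2, c.1)).2, (s (c.2, c.1)).1).
Proof. by rewrite permE. Qed.

Lemma routed_flip n s : routed M n s -> routed M n (flip_perm s).
Proof.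
move=> [l [<- hl ->]]; exists (map flip_perm l); rewrite size_map; split=> //.
  move=> _ /mapP[r rl ->]; have [rK [e [z hr]]] := hl r rl; split.
    by move=> [i j]; rewrite !flip_permE /= -surjective_pairing rK.
  exists e, z; case: hr => hr; [right|left] => -[i j]; rewrite flip_permE /=;
    have [->|hc] := hr (j, i); by [left | right].
elim: l {hl} => [|r l IH].
  by apply/permP => -[i j]; rewrite !big_nil flip_permE !perm1.
apply/permP => -[i j].
by rewrite /= !big_cons permM -IH !flip_permE permM /= -surjective_pairing.
Qed.
End Transpose.

Section GridRouting.
Local Open Scope group_scope.
Variables (M p q : nat).
Hypothesis M_gt1 : 1 < M.
Local Notation V := ('I_p * 'I_q)%type.


(** Colour the token that starts in column [j] and ends in column [j'] as an edge
    from [j] to [j'], with the rows as colours. Moving every token inside its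
    column to the row given by its colour leaves, in each row, one token for each
    destination column. *)
Theorem grid_routing (s : {perm V}) :
  routed M (M * (p.*2 * M) + M * (q.*2 * M) + M * (p.*2 * M)) s.
Proof.
have card_column j : #|[set e : V | e.2 == j]| = p.
  rewrite -[RHS](card_ord p) -(card_imset predT (f := fun i : 'I_p => (i, j))); last first.
    by move=> i i' [].
  apply: eq_card => -[i j']; rewrite !inE /=; apply/eqP/imsetP => [->|[i' _ [_ ->]]] //.
  by exists i.
have [|j|r [rp r_src r_dst]] := @regular_edge_coloring V 'I_q snd (fun e => (s e).2) p setT.
- by move=> j; rewrite -[RHS](card_column j); apply: eq_card => e; rewrite !inE.
- rewrite -[RHS](card_column j) -(card_imset _ (@perm_inj _ s)).
  apply: eq_card => e; rewrite !inE; apply/imsetP/eqP => [[e']|ej].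
    by rewrite !inE => /eqP ej ->.
  by exists (s^-1 e); rewrite ?inE permKV ?ej ?eqxx.
pose row e := Ordinal (rp e (in_setT e)).
have row_src e e' : row e = row e' -> e.2 = e'.2 -> e = e'.
  by move=> [] h1 h2; apply: r_src; rewrite ?in_setT.
have row_dst e e' : row e = row e' -> (s e).2 = (s e').2 -> e = e'.
  by move=> [] h1 h2; apply: r_dst; rewrite ?in_setT.
have a_inj j : injective (fun i => row (i, j)).
  by move=> i i' /row_src/(_ erefl)[].
pose a j := perm (@a_inj j).
have aK i j : row ((a j)^-1 i, j) = i.
  by have := permKV (a j) i; rewrite {1}permE.
have b_inj i : injective (fun j => (s ((a j)^-1 i, j)).2).
  by move=> j j' ej; have := row_dst _ _ _ ej; rewrite !aK => /(_ erefl)[].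
pose b i := perm (@b_inj i).
pose A := column_perm a; pose B := flip_perm (column_perm b).
have AB e : (A * B) e = (row e, (s e).2).
  rewrite permM column_permE flip_permE column_permE /=.
  have -> : a e.2 e.1 = row e by rewrite permE -surjective_pairing.
  rewrite permE; congr (_, (s _).2).
  by apply: row_src => //; rewrite aK.
have [c cE] : exists c, (A * B)^-1 * s = column_perm c.
  apply: column_perm_of => v; rewrite permM.
  by rewrite -{2}(permKV (A * B) v) AB.
have -> : s = A * B * column_perm c by rewrite -cE mulKVg.
apply: routedM (routed_column_perm M_gt1 _); apply: routedM.
  exact: routed_column_perm.
exact/routed_flip/routed_column_perm.
Qed.
End GridRouting.

(** * Programs of moves and sets of holes *)

Section PermFacts.
Local Open Scope group_scope.
Variable T : finType.
Implicit Types (r s : {perm T}) (H : {set T}).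

Lemma mem_perm_imset r H c : (c \in r @: H) = (r^-1 c \in H).
Proof. by rewrite (can_imset_pre _ (permK r)) inE. Qed.

(** The images are corrected one index at a time by a transposition, which does
    not disturb the earlier ones since [u] and [v] are injective. *)
Lemma perm_extend (I : finType) (u v : I -> T) : injective u -> injective v ->
  exists s : {perm T}, forall i, s (u i) = v i.
Proof.
move=> u_inj v_inj.
suff [s hs] : exists s : {perm T}, {in enum I, forall i, s (u i) = v i}.
  by exists s => i; apply: hs; rewrite mem_enum.
elim: (enum I) => [|i l [s hs]]; first by exists 1.
have [il|il] := boolP (i \in l).
  by exists s => k; rewrite inE => /predU1P[->|]; apply: hs.
exists (s * tperm (s (u i)) (v i)) => k; rewrite inE permM.
case/predU1P=> [->|kl]; first by rewrite tpermL.
have nki : i != k by apply: contraNneq il => ->.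
rewrite (hs k kl) tpermD //; last by rewrite (inj_eq v_inj).
by rewrite -(hs k kl) (inj_eq perm_inj) (inj_eq u_inj).
Qed.

Lemma perm_card_eq H H' : #|H| = #|H'| -> exists s : {perm T}, s @: H = H'.
Proof.
move=> eqc; have v_inj : injective (fun i => enum_val (cast_ord eqc i)).
  by move=> i j /enum_val_inj/cast_ord_inj.
have [s hs] := perm_extend (@enum_val_inj _ (mem H)) v_inj.
exists s; apply/eqP; rewrite eqEcard card_imset; last exact: perm_inj.
rewrite eqc leqnn andbT; apply/subsetP => _ /imsetP[c cH ->].
by rewrite -(enum_rankK_in cH cH) hs enum_valP.
Qed.
End PermFacts.

Section Slides.
Local Open Scope group_scope.
Variables (T : finType) (adj : rel T).
Hypothesis adjC : symmetric adj.
Implicit Types (r s : {perm T}) (H A B : {set T}) (l : seq {perm T}) (c : T).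

(** One time step, described by a permutation of the cells under which every cell
    outside [H] stays or goes to an adjacent cell of [H]. The labels of the
    pieces do not occur here, so one program serves all configurations whose
    pieces avoid [H]. *)
Definition slide H r :=
  [forall c, (c \notin H) ==> (r c == c) || adj c (r c) && (r c \in H)].

Fixpoint legal H l := if l is r :: l' then slide H r && legal (r @: H) l' else true.

Definition effect l : {perm T} := \prod_(r <- l) r.

Lemma slideP H r :
  reflect (forall c, c \notin H -> r c = c \/ adj c (r c) /\ r c \in H) (slide H r).
Proof.
apply: (iffP forall_inP) => h c /h.
  by case/orP=> [/eqP|/andP]; [left|right].
by case=> [->|[-> ->]]; rewrite ?eqxx ?orbT.
Qed.

Lemma effect_nil : effect [::] = 1.
Proof. exact: big_nil. Qed.

Lemma effect_cons r l : effect (r :: l) = r * effect l.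
Proof. exact: big_cons. Qed.

Lemma effect_cat l l' : effect (l ++ l') = effect l * effect l'.
Proof. exact: big_cat. Qed.

Lemma imsetM r s H : (r * s) @: H = s @: (r @: H).
Proof. by rewrite -imset_comp; apply: eq_imset => c; rewrite permM. Qed.

Lemma imset_perm1 H : (1 : {perm T}) @: H = H.
Proof. by rewrite -[RHS]imset_id; apply: eq_imset => c; rewrite perm1. Qed.

Lemma legal_cat H l l' : legal H (l ++ l') = legal H l && legal (effect l @: H) l'.
Proof.
elim: l H => [|r l IH] H /=; first by rewrite effect_nil imset_perm1.
by rewrite IH effect_cons imsetM andbA.
Qed.

Lemma slide1 H : slide H 1.
Proof. by apply/slideP => c _; left; rewrite perm1. Qed.

Lemma legal_pad H l n : legal H l ->
  legal H (l ++ nseq n 1) /\ effect (l ++ nseq n 1) = effect l.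
Proof.
move=> hl; have e1 : effect (nseq n 1) = 1.
  by rewrite /effect big1_seq // => r /andP[_ /nseqP[]].
rewrite effect_cat e1 mulg1 legal_cat hl; split=> //=.
by elim: n {e1} (_ @: H) => //= n IH H'; rewrite slide1 imset_perm1 IH.
Qed.

(** Had the cell that a piece vacates been refilled in the same step, the piece
    that refills it would have entered an occupied cell. *)
Lemma slideV H r : slide H r -> slide (r @: H) r^-1.
Proof.
move=> /slideP hr; apply/slideP => c; rewrite !mem_perm_imset => cH.
have := hr _ cH; rewrite permKV => -[e|[cadj rcH]]; first by left.
right; split; first by rewrite adjC.
apply: contraLR cH => /hr; rewrite permKV negbK => -[e|[_ //]].
by rewrite -(perm_inj e).
Qed.

Lemma legal_rev H l : legal H l ->
  legal (effect l @: H) (rev (map invg l)) /\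
  effect (rev (map invg l)) = (effect l)^-1.
Proof.
elim: l H => [|r l IH] H /=; first by rewrite effect_nil invg1.
move=> /andP[hr /IH[IH1 IH2]].
have eE : effect (rev (map invg (r :: l))) = (effect (r :: l))^-1.
  by rewrite /= rev_cons -cats1 effect_cat IH2 !effect_cons effect_nil mulg1 invMg.
split=> //; rewrite rev_cons -cats1 legal_cat effect_cons imsetM IH1 IH2 /=.
rewrite -imsetM mulgV imset_perm1 andbT; exact: slideV.
Qed.

(** Programs confined to disjoint regions can run at the same time: a step
    only looks at the holes of the region that it moves. *)
Lemma legal_merge A B H H1 H2 l1 l2 :
  [disjoint A & B] -> size l1 = size l2 ->
  all (perm_on A) l1 -> all (perm_on B) l2 ->
  {in A, H =i H1} -> {in B, H =i H2} -> legal H1 l1 -> legal H2 l2 ->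
  exists l, [/\ size l = size l1, all (perm_on (A :|: B)) l, legal H l,
    {in A, effect l =1 effect l1} & {in B, effect l =1 effect l2}].
Proof.
move=> dAB; elim: l1 l2 H H1 H2 => [|r1 l1 IH] [|r2 l2] H H1 H2 //=.
  by move=> *; exists [::].
move=> [sz] /andP[on1 onl1] /andP[on2 onl2] eq1 eq2.
move=> /andP[/slideP s1 leg1] /andP[/slideP s2 leg2].
have AB c : c \in A -> c \notin B by move=> cA; rewrite (disjointFr dAB).
have BA c : c \in B -> c \notin A by move=> cB; rewrite (disjointFl dAB).
have cl1 := perm_closed _ on1; have cl2 := perm_closed _ on2.
have rA c : c \in A -> (r1 * r2) c = r1 c.
  by move=> cA; rewrite permM (out_perm on2) // AB ?cl1.
have rB c : c \in B -> (r1 * r2) c = r2 c.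
  by move=> cB; rewrite permM (out_perm on1) // BA.
have on12 : perm_on (A :|: B) (r1 * r2).
  apply/subsetP => c; rewrite !inE; apply: contraR; rewrite negb_or => /andP[cA cB].
  by rewrite permM (out_perm on1) // (out_perm on2).
have vA c : c \in A -> (r1 * r2)^-1 c = r1^-1 c.
  by move=> cA; apply: (canLR (permK _)); rewrite rA ?permKV // -cl1 permKV.
have vB c : c \in B -> (r1 * r2)^-1 c = r2^-1 c.
  by move=> cB; apply: (canLR (permK _)); rewrite rB ?permKV // -cl2 permKV.
have [c cA|c cB|l [szl onl leg effA effB]] := IH l2 ((r1 * r2) @: H) _ _ sz onl1 onl2 _ _ leg1 leg2.
- by rewrite !mem_perm_imset vA // eq1 // -cl1 permKV.
- by rewrite !mem_perm_imset vB // eq2 // -cl2 permKV.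
exists (r1 * r2 :: l); split=> /=.
- by rewrite szl.
- by rewrite on12.
- rewrite leg andbT; apply/slideP => c cH.
  have [cA|cA] := boolP (c \in A).
    by rewrite rA // eq1 ?cl1 //; apply: s1; rewrite -eq1.
  have [cB|cB] := boolP (c \in B).
    by rewrite rB // eq2 ?cl2 //; apply: s2; rewrite -eq2.
  by left; rewrite permM (out_perm on1) // (out_perm on2).
- by move=> c cA; rewrite !effect_cons permM rA // effA ?cl1 // -permM.
- by move=> c cB; rewrite !effect_cons permM rB // effB ?cl2 // -permM.
Qed.

Lemma effect_perm_on A l : all (perm_on A) l -> perm_on A (effect l).
Proof.
elim: l => [|r l IH] /=; first by rewrite effect_nil perm_on1.
by move=> /andP[h1 /IH h2]; rewrite effect_cons perm_onM.
Qed.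

Lemma legal_parallel (I : finType) (P : pred I) (A : I -> {set T})
    (L : I -> seq {perm T}) H n :
  (forall i, P i -> [/\ size (L i) = n, all (perm_on (A i)) (L i) & legal H (L i)]) ->
  (forall i j, P i -> P j -> i != j -> [disjoint A i & A j]) ->
  exists l, [/\ size l = n, legal H l,
    (forall i, P i -> {in A i, effect l =1 effect (L i)}) &
    (forall c, (forall i, P i -> c \notin A i) -> effect l c = c)].
Proof.
move=> hL dA.
suff [l [sz on leg eff]] : exists l, [/\ size l = n,
    all (perm_on (\bigcup_(i <- enum P) A i)) l, legal H l &
    {in enum P, forall i, {in A i, effect l =1 effect (L i)}}].
  exists l; split=> // [i Pi|c cA]; first by apply: eff; rewrite mem_enum.
  apply: (out_perm (effect_perm_on on)).
  by rewrite big_enum /=; apply/bigcupP => -[i /cA/negPf->].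
have : {subset enum P <= P} by move=> i; rewrite mem_enum.
elim: (enum P) (enum_uniq P) => [_ _|i e IH /= /andP[ie ue] sub].
  exists (nseq n 1); have [//|h1 h2] := @legal_pad H [::] n.
  rewrite size_nseq; split=> //; apply/allP => r /nseqP[-> _]; exact: perm_on1.
have [//|j je|l [sz on leg eff]] := IH.
  by apply: sub; rewrite inE je orbT.
have Pi : P i by apply: (sub i); rewrite inE eqxx.
have [szi oni legi] := hL i Pi.
have [||//|//|l' [sz' on' leg' eff1 eff2]] := @legal_merge (A i) _ H H H (L i) l _ _ oni on _ _ legi leg.
- rewrite disjoint_subset; apply/subsetP => c ci; rewrite inE bigcup_seq.
  apply/bigcupP => -[j je cj]; rewrite (disjointFr (dA i j Pi _ _) ci) // in cj.
    by apply: (sub j); rewrite inE je orbT.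
  by apply: contraNneq ie => ->.
- by rewrite szi.
exists l'; rewrite big_cons sz'; split=> // j; rewrite inE.
case/predU1P=> [->//|je] c cj; rewrite eff2; first exact: eff.
by rewrite bigcup_seq; apply/bigcupP; exists j.
Qed.

(** In a matching exchange the pairs of two pieces and of two holes can be
    left alone, since the set of holes does not see them. *)
Lemma slide_matching H r : involutive r -> (forall c, r c = c \/ adj c (r c)) ->
  exists r', slide H r' /\ r' @: H = r @: H.
Proof.
move=> rK radj; pose f c := if (c \in H) != (r c \in H) then r c else c.
have fK : involutive f.
  move=> c; rewrite /f; case h: ((c \in H) != (r c \in H)); last by rewrite h.
  by rewrite rK eq_sym h.
exists (perm (can_inj fK)); split.
  apply/slideP => c cH; rewrite permE /f (negPf cH).
  case: ifP => h; last by left.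
  have [->|] := radj c; [by left | right; split=> //].
  by move: h; case: (_ \in _).
have im (s : {perm T}) : involutive s -> forall c, (c \in s @: H) = (s c \in H).
  by move=> sK c; rewrite mem_perm_imset (canLR (permK _) (esym (sK c))).
apply/setP => c; rewrite (im r rK) im ?permE => [|d]; last by rewrite !permE fK.
rewrite /f; by case: ifP => // /negbFE/eqP.
Qed.

End Slides.

(** * Exchanging two pieces with the help of two holes *)

Section Gadgets.
Local Open Scope group_scope.
Variables (T : finType) (adj : rel T).
Hypothesis adjC : symmetric adj.
Implicit Types (H A : {set T}) (l : seq {perm T}).

Lemma slide_tperm H a b : adj a b -> a \in H -> slide adj H (tperm a b).
Proof.
move=> ab aH; apply/slideP => c cH; case: tpermP => [ca|->|_ _]; last by left.
  by rewrite -ca (negPf cH) in aH.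
by right; rewrite adjC.
Qed.

Lemma perm_on_tperm A a b : a \in A -> b \in A -> perm_on A (tperm a b).
Proof.
move=> aA bA; apply/subsetP => c; rewrite inE.
by case: tpermP => [->|->|]; rewrite ?eqxx.
Qed.

Lemma mem_imset_tperm H a b c : (c \in tperm a b @: H) = (tperm a b c \in H).
Proof. by rewrite mem_perm_imset tpermV. Qed.

Lemma imset_tperm H a b : (a \in H) = (b \in H) -> tperm a b @: H = H.
Proof.
move=> ab; apply/setP => c; rewrite mem_perm_imset tpermV.
by case: tpermP => [->|->|].
Qed.

(** Two pieces on one side of a square whose other side is empty change places
    by circulating around it. *)
Lemma square_swap A H x y x' y' :
  adj x x' -> adj x y -> adj x' y' -> adj y' y ->
  x \in A -> y \in A -> x' \in A -> y' \in A ->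
  uniq [:: x; y; x'; y'] -> x' \in H -> y' \in H ->
  exists l, [/\ size l = 4, all (perm_on A) l, legal adj H l &
                effect l = tperm x y * tperm x' y'].
Proof.
move=> xx' xy xy' yy' xA yA x'A y'A.
rewrite /= !inE !negb_or !andbT => /andP[/and3P[n1 n2 n3] /andP[/andP[n4 n5] n6]] x'H y'H.
have [m1 m2 m3] : [/\ y != x, x' != x & y' != x] by rewrite !(eq_sym _ x).
have [m4 m5 m6] : [/\ x' != y, y' != y & y' != x'].
  by split; rewrite eq_sym.
have [x'x y'x' ay] : [/\ adj x' x, adj y' x' & adj y y'] by split; rewrite adjC.
exists [:: tperm x' x; tperm x y; tperm y' x'; tperm y y']; split=> //.
- by apply/allP => s; rewrite !inE => /or4P[] /eqP ->; apply: perm_on_tperm.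
- apply/and5P; split=> //; apply: slide_tperm => //; rewrite !mem_imset_tperm.
  + by rewrite tpermR.
  + by rewrite (tpermD (z := y')) // tpermD.
  + by rewrite (tpermD (z := y)) // tpermR tpermR.
rewrite !effect_cons effect_nil mulg1; apply/permP => c; rewrite !permM.
have [->|cx] := eqVneq c x.
  by rewrite tpermR (tpermD (z := x')) // tpermR tpermR tpermL tpermD.
have [->|cy] := eqVneq c y.
  by rewrite (tpermD (z := y)) // tpermR !tpermD.
have [->|cx'] := eqVneq c x'.
  by rewrite tpermL tpermL (tpermD (z := y)) // tpermL (tpermD (z := x')) // tpermL.
have [->|cy'] := eqVneq c y'.
  rewrite (tpermD (x := x') (y := x)) // (tpermD (x := x) (y := y)) //.
  by rewrite tpermL tpermR tpermD.
by rewrite 6?tpermD // eq_sym.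
Qed.

(** Undoing the preparation [l] after the exchange gives a conjugate of a product
    of two transpositions. The second one permutes two holes, and hence is not
    visible on the pieces. *)
Lemma conjugate_swap A H l x y x' y' a b hx hy :
  legal adj H l -> all (perm_on A) l ->
  effect l a = x -> effect l b = y -> effect l hx = x' -> effect l hy = y' ->
  a \notin H -> b \notin H -> hx \in H -> hy \in H -> a != b -> hx != hy ->
  adj x x' -> adj x y -> adj x' y' -> adj y' y ->
  x \in A -> y \in A -> x' \in A -> y' \in A ->
  exists l', [/\ size l' = (size l).*2 + 4, all (perm_on A) l', legal adj H l' &
                effect l' = tperm a b * tperm hx hy].
Proof.
move=> leg on ea eb ehx ehy aH bH hxH hyH nab nh xx' xy xy' yy' xA yA x'A y'A.
have im c : (effect l c \in effect l @: H) = (c \in H).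
  by rewrite mem_perm_imset permK.
have [] := @square_swap A (effect l @: H) x y x' y' xx' xy xy' yy' xA yA x'A y'A.
- rewrite -ea -eb -ehx -ehy (map_inj_uniq (@perm_inj _ (effect l)) [:: a; b; hx; hy]).
  rewrite /= !inE !negb_or nab nh !andbT /=.
  by do ![apply/andP; split]; [move: aH | move: aH | move: bH | move: bH];
    apply: contraNneq => ->.
- by rewrite -ehx im.
- by rewrite -ehy im.
move=> g [szg ong legg eg]; have [legV eV] := legal_rev adjC leg.
exists (l ++ g ++ rev (map invg l)); split.
- by rewrite !size_cat size_rev size_map szg addnCA addnn addnC.
- rewrite !all_cat on ong all_rev all_map; apply: sub_all on => s hs /=.
  by rewrite perm_onV.
- rewrite !legal_cat leg legg /= eg imsetM (@imset_tperm _ x y) ?(@imset_tperm _ x' y') //.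
    by rewrite -ehx -ehy !im hxH hyH.
  by rewrite -ea -eb !im (negPf aH) (negPf bH).
rewrite !effect_cat eg eV mulgA -[LHS]mulgA.
have -> : effect l * (tperm x y * tperm x' y' * (effect l)^-1)
   = (tperm x y * tperm x' y') ^ (effect l)^-1 by rewrite conjgE invgK.
by rewrite conjMg !tpermJ -ea -eb -ehx -ehy !permK.
Qed.

(** In a two by three rectangle whose middle column is empty, four moves put
    the two outer pieces of a row side by side, above two empty cells. *)
Lemma rectangle_gather A H a1 a2 a3 b1 b2 b3 :
  adj a2 a3 -> adj b2 b1 -> adj a3 b3 -> adj b3 b2 ->
  a2 \in A -> a3 \in A -> b1 \in A -> b2 \in A -> b3 \in A ->
  uniq [:: a1; a2; a3; b1; b2; b3] -> a2 \in H -> b2 \in H ->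
  exists l, [/\ size l = 4, all (perm_on A) l, legal adj H l &
    [/\ effect l a1 = a1, effect l a3 = a2, effect l b2 = b1 & effect l a2 = b2]].
Proof.
move=> h1 h2 h3 h4 a2A a3A b1A b2A b3A un a2H b2H.
exists [:: tperm a2 a3; tperm b2 b1; tperm a3 b3; tperm b3 b2].
have ne i j : i < 6 -> j < 6 -> i != j ->
    nth a1 [:: a1; a2; a3; b1; b2; b3] i != nth a1 [:: a1; a2; a3; b1; b2; b3] j.
  by move=> hi hj; rewrite nth_uniq.
have [a21 a31 [b11 b21 b31]] : [/\ a2 != a1, a3 != a1 & [/\ b1 != a1, b2 != a1 & b3 != a1]].
  by split; [exact: (ne 1%N 0%N isT isT isT) | exact: (ne 2%N 0%N isT isT isT) | split;
    [exact: (ne 3%N 0%N isT isT isT) | exact: (ne 4%N 0%N isT isT isT) | exact: (ne 5%N 0%N isT isT isT)]].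
have [b22 b12 [a32 b32]] : [/\ b2 != a2, b1 != a2 & a3 != a2 /\ b3 != a2].
  by split; [exact: (ne 4%N 1%N isT isT isT) | exact: (ne 3%N 1%N isT isT isT) | split; [exact: (ne 2%N 1%N isT isT isT) | exact: (ne 5%N 1%N isT isT isT)]].
have [a2b2 a3b2 [a3b1 b3b1 b2b1]] :
    [/\ a2 != b2, a3 != b2 & [/\ a3 != b1, b3 != b1 & b2 != b1]].
  by split; [exact: (ne 1%N 4%N isT isT isT) | exact: (ne 2%N 4%N isT isT isT) | split;
    [exact: (ne 2%N 3%N isT isT isT) | exact: (ne 5%N 3%N isT isT isT) | exact: (ne 4%N 3%N isT isT isT)]].
have [b2a3 b1a3] : b2 != a3 /\ b1 != a3 by split; [exact: (ne 4%N 2%N isT isT isT) | exact: (ne 3%N 2%N isT isT isT)].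
have [b2b3 b1b3] : b2 != b3 /\ b1 != b3 by split; [exact: (ne 4%N 5%N isT isT isT) | exact: (ne 3%N 5%N isT isT isT)].
split=> //.
- by apply/allP => s; rewrite !inE => /or4P[] /eqP ->; apply: perm_on_tperm.
- apply/and5P; split=> //; apply: slide_tperm => //; rewrite !mem_imset_tperm.
  + by rewrite tpermD.
  + by rewrite (tpermD (z := a3)) // tpermR.
  + by rewrite tpermR (tpermD (z := a3)) // tpermR.
rewrite !effect_cons effect_nil mulg1; split; rewrite !permM.
- by rewrite !tpermD.
- by rewrite tpermR !tpermD.
- by rewrite (tpermD (z := b2)) // tpermL !tpermD.
- by rewrite tpermL (tpermD (z := a3)) // tpermL tpermL.
Qed.
End Gadgets.

(** * Empty columns and simulated swaps *)

Section Comb.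
Local Open Scope group_scope.
Variables (m' d B : nat).
Local Notation m := m'.+1.
Hypothesis d_gt0 : 0 < d.
Hypothesis mE : m = (d.+1 * B)%N.
Local Notation V := ('I_m * 'I_(d * B))%type.
Local Notation C := ('I_m * 'I_m)%type.
Implicit Types (c : V) (A H : {set C}).

Lemma side_gt1 : 1 < m.
Proof. by move: mE; case: B => [|b]; [lia | nia]. Qed.

Definition at_cell (x y : nat) : C := (inord x, inord y).

Lemma cell_eq (a b : C) : a.1 = b.1 :> nat -> a.2 = b.2 :> nat -> a = b.
Proof. by case: a b => [? ?] [? ?] /= /ord_inj -> /ord_inj ->. Qed.

Lemma at_cell_eq x y x' y' : x < m -> y < m -> x' < m -> y' < m ->
  (at_cell x y == at_cell x' y') = (x == x') && (y == y').
Proof.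
by move=> *; rewrite -pair_eqE /pair_eq /= -!val_eqE /= !inordK.
Qed.

Lemma at_cell_adj x y x' y' : x < m -> y < m -> x' < m -> y' < m ->
  cell_adj (at_cell x y) (at_cell x' y')
  = (x == x') && ((y.+1 == y') || (y'.+1 == y)) ||
    (y == y') && ((x.+1 == x') || (x'.+1 == x)).
Proof.
by move=> *; rewrite /cell_adj /consecutive /= -!val_eqE /= !inordK.
Qed.

Lemma cell_adjC : symmetric (@cell_adj m).
Proof.
move=> a b; rewrite /cell_adj /consecutive (eq_sym b.1) (eq_sym b.2).
by rewrite (orbC (b.1.+1 == _)) (orbC (b.2.+1 == _)).
Qed.

Definition empty_columns : {set C} := [set a : C | d.+1 %| a.2].
(** The grid is cut into blocks of [d + 1] columns, the first of which is empty.
    The other columns are numbered consecutively as the columns of a virtual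
    grid; virtual column [v] is the column that follows [gap_column v], and the
    hole of its block reaches [gap_column v] by passing the pieces on its left. *)
Definition gap_column (v : nat) := v + v %/ d.
Definition embed (c : V) : C := at_cell c.1 (gap_column c.2).+1.
Definition ball (x y : nat) : {set C} :=
  [set a : C | [&& a.1 <= x.+1, x <= a.1.+1, a.2 <= y + d.+1 & y <= a.2 + d.+1]].

Lemma gap_columnE v : gap_column v = (d.+1 * (v %/ d) + v %% d)%N.
Proof. by rewrite /gap_column {1}(divn_eq v d); clear; lia. Qed.

Lemma gap_column_ltn v : v < d * B -> (gap_column v).+1 < m.
Proof.
move=> hv; rewrite mE gap_columnE.
have hq : v %/ d < B by rewrite ltn_divLR // mulnC.
have := ltn_pmod v d_gt0; nia.
Qed.

Lemma gap_column_leq v w : v <= w -> gap_column v + (w - v) <= gap_column w.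
Proof. by move=> vw; have := leq_div2r d vw; rewrite /gap_column; clear -vw; lia. Qed.

Lemma embed_inj : injective embed.
Proof.
move=> [x v] [y w] /eqP; rewrite at_cell_eq ?ltn_ord ?gap_column_ltn //=.
case/andP=> /eqP/ord_inj -> /eqP /= [e]; congr (_, _); apply: ord_inj.
by case: (ltngtP v w) => // /ltnW/[dup]/gap_column_leq; lia.
Qed.

Lemma embed_notin_empty_columns c : embed c \notin empty_columns.
Proof.
have hv := gap_column_ltn (ltn_ord c.2).
rewrite inE /= inordK // gap_columnE -addnS dvdn_addr ?dvdn_mulr //.
by rewrite gtnNdvd // ltnS ltn_pmod.
Qed.

Lemma notin_empty_columnsP a : a \notin empty_columns -> exists c, a = embed c.
Proof.
rewrite inE => na; have am : a.2 < d.+1 * B by rewrite -mE; exact: ltn_ord.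
have e := divn_eq a.2 d.+1; have lt1 := ltn_pmod a.2 (ltn0Sn d).
have r0 : 0 < a.2 %% d.+1 by rewrite lt0n.
have lt2 : a.2 %/ d.+1 < B by rewrite ltn_divLR // mulnC.
pose v := (a.2 %/ d.+1 * d + (a.2 %% d.+1).-1)%N.
have hv : v < d * B by rewrite /v; nia.
have rd : (a.2 %% d.+1).-1 < d by rewrite -ltnS prednK.
have vd : v %/ d = a.2 %/ d.+1 by rewrite /v divnMDl // (divn_small rd) addn0.
exists (a.1, Ordinal hv); apply: cell_eq; rewrite /= ?inord_val // inordK.
  by move: e (prednK r0); rewrite mulnS /gap_column /= vd /v; lia.
exact: gap_column_ltn.
Qed.

Definition hole_run x y t : seq {perm C} :=
  [seq tperm (at_cell x (y + k)) (at_cell x (y + k.+1)) | k <- iota 0 t].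

Lemma hole_runS x y t : hole_run x y t.+1
  = hole_run x y t ++ [:: tperm (at_cell x (y + t)) (at_cell x (y + t.+1))].
Proof.
rewrite /hole_run; have -> : iota 0 t.+1 = iota 0 t ++ [:: t] by rewrite -addn1 iotaD add0n.
by rewrite map_cat.
Qed.

Lemma effect_hole_run x y t : x < m -> y + t < m ->
  effect (hole_run x y t) (at_cell x y) = at_cell x (y + t) /\
  forall a : C, (a.1 != x :> nat) || (a.2 < y) || (y + t < a.2) ->
    effect (hole_run x y t) a = a.
Proof.
move=> xm; elim: t => [|t IH] ytm.
  by rewrite effect_nil addn0; split=> [|a _]; rewrite perm1.
have [|e1 e2] := IH; first lia.
rewrite hole_runS effect_cat effect_cons effect_nil mulg1; split=> [|a ha].
  by rewrite permM e1 tpermL.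
rewrite permM e2; last by move: ha; lia.
by rewrite tpermD //; apply: contraTneq ha => <-; rewrite /= !inordK //; lia.
Qed.

Lemma effect_hole_run_last x y t : x < m -> y + t.+1 < m ->
  effect (hole_run x y t.+1) (at_cell x (y + t.+1)) = at_cell x (y + t).
Proof.
move=> xm ytm; rewrite hole_runS effect_cat effect_cons effect_nil mulg1 permM.
have [||_ ->] := @effect_hole_run x y t; try lia; first by rewrite tpermR.
by rewrite /= !inordK //; lia.
Qed.

Lemma legal_hole_run H x y t : x < m -> y + t < m -> at_cell x y \in H ->
  legal (@cell_adj m) H (hole_run x y t).
Proof.
move=> xm; elim: t => [|t IH] ytm xyH //.
rewrite hole_runS legal_cat IH //=; last lia.
rewrite andbT; apply: slide_tperm; first exact: cell_adjC.
  by rewrite at_cell_adj; lia.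
have [||<- _] := @effect_hole_run x y t; try lia.
by apply: imset_f.
Qed.

Lemma hole_run_on A x y t : (forall k, k <= t -> at_cell x (y + k) \in A) ->
  all (perm_on A) (hole_run x y t).
Proof.
move=> hA; apply/allP => r /mapP[k]; rewrite mem_iota => /andP[_ kt] ->.
by apply: perm_on_tperm; apply: hA; lia.
Qed.

Lemma at_cell_ball a x b y : a < m -> b < m ->
  (at_cell a b \in ball x y)
  = [&& a <= x.+1, x <= a.+1, b <= y + d.+1 & y <= b + d.+1].
Proof. by move=> am bm; rewrite inE /= !inordK. Qed.

Lemma at_cell_empty_columns x k : x < m -> d.+1 * k < m -> at_cell x (d.+1 * k)%N \in empty_columns.
Proof. by move=> xm km; rewrite inE /= inordK // dvdn_mulr. Qed.

(** Once the holes of both rows are in column [h], the pieces of virtual columns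
    [v.-1] and [v] are on both sides of it. This also covers the first virtual
    column of a block, where the holes are in place from the beginning and the
    left neighbour belongs to the preceding block. *)
Lemma open_gap x x' v z : x < m -> x' < m -> x != x' -> v < d * B ->
  z <= x.+1 -> x <= z.+1 -> z <= x'.+1 -> x' <= z.+1 ->
  let y := (d.+1 * (v %/ d))%N in let h := gap_column v in
  exists l, [/\ size l = (v %% d).*2, all (perm_on (ball z h)) l,
    legal (@cell_adj m) empty_columns l &
    [/\ effect l (at_cell x y) = at_cell x h,
        effect l (at_cell x' y) = at_cell x' h,
        (forall a : C, h < a.2 -> effect l a = a) &
        (forall w, w.+1 = v ->
           effect l (at_cell x (gap_column w).+1) = at_cell x h.-1)]].
Proof.
move=> xm x'm nxx' vm z1 z2 z3 z4 y h.
have hE : h = y + v %% d by rewrite /h gap_columnE.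
have hm : y + v %% d < m by rewrite -hE ltnW // gap_column_ltn.
have ym : y < m by apply: leq_ltn_trans hm; rewrite leq_addr.
have td : v %% d < d by rewrite ltn_mod.
have [e1 e2] := effect_hole_run xm hm.
have [e1' e2'] := effect_hole_run x'm hm.
have fix1 : effect (hole_run x y (v %% d)) (at_cell x' y) = at_cell x' y.
  by apply: e2; rewrite /= inordK // eq_sym nxx'.
exists (hole_run x y (v %% d) ++ hole_run x' y (v %% d)); split.
- by rewrite size_cat !size_map size_iota addnn.
- rewrite all_cat; apply/andP; split; apply: hole_run_on => k kt;
    rewrite at_cell_ball ?hE //; clear - z1 z2 z3 z4 kt td hm; lia.
- rewrite legal_cat !legal_hole_run // ?at_cell_empty_columns //.
  by rewrite -fix1 mem_perm_imset permK at_cell_empty_columns.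
rewrite effect_cat; split=> [|||w wv]; rewrite ?permM.
- by rewrite e1 hE; apply: e2'; rewrite /= inordK // nxx'.
- by rewrite fix1 e1' hE.
- by move=> a ha; rewrite permM e2 ?e2' // -hE ha !orbT.
have shw : (gap_column w).+1 = (if d %| v then h.-1 else h).
  by rewrite /h /gap_column -wv divnS //; case: (d %| w.+1); rewrite ?add1n ?add0n ?addnS ?addSn.
have hsm : h.-1 < m by rewrite hE; clear -hm; lia.
(* If [v] starts a block, then [h = y] and the piece of column [w] does not move;
   otherwise the last move of the hole pushes it from [h] to [h.-1]. *)
rewrite shw; case: ifP => dv.
  have v0 : 0 < v %/ d by rewrite divn_gt0 // dvdn_leq // -wv.
  have yh : h.-1 < y.
    move: v0; rewrite hE (eqP dv) addn0 /y; clear -d_gt0; nia.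
  by rewrite e2 ?e2' //= !inordK // ?yh ?orbT ?nxx'.
have [t tE] : exists t, v %% d = t.+1.
  by exists (v %% d).-1; rewrite prednK // lt0n; apply/negbT.
rewrite hE tE /= addnS; rewrite tE addnS in hm.
rewrite -addnS effect_hole_run_last ?addnS //=.
by rewrite -tE e2' //= !inordK ?nxx' // ltnW.
Qed.

(** The longest program consists of two hole runs of at most [d.-1] steps and four
    gathering moves, the same backwards, and the four steps around the square. *)
Definition swap_time := (d * 4 + 8)%N.

Lemma finish_swap A l (c c' : V) hx hy : size l <= swap_time ->
  all (perm_on A) l -> legal (@cell_adj m) empty_columns l ->
  effect l = tperm (embed c) (embed c') * tperm hx hy ->
  hx \in empty_columns -> hy \in empty_columns ->
  exists l', [/\ size l' = swap_time, all (perm_on A) l',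
     legal (@cell_adj m) empty_columns l' &
     forall e, effect l' (embed e) = embed (tperm c c' e)].
Proof.
move=> sz on leg el hxs hys.
have [legp effp] := legal_pad (swap_time - size l) leg.
exists (l ++ nseq (swap_time - size l) 1); split=> [||//|e].
- by rewrite size_cat size_nseq subnKC.
- by rewrite all_cat on; apply/allP => r /nseqP[-> _]; apply: perm_on1.
rewrite effp el permM -(inj_tperm _ _ _ embed_inj) (tpermD (x := hx) (y := hy)) //.
  by apply: contraTneq hxs => ->; apply: embed_notin_empty_columns.
by apply: contraTneq hys => ->; apply: embed_notin_empty_columns.
Qed.

(** With both holes in the gap column, the two pieces on their right and the holes
    form a square. *)
Lemma vertical_swap (c c' : V) : c'.2 = c.2 -> c'.1 = c.1.+1 :> nat ->
  exists l, [/\ size l = swap_time, all (perm_on (ball c.1 (gap_column c.2))) l,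
     legal (@cell_adj m) empty_columns l &
     forall e, effect l (embed e) = embed (tperm c c' e)].
Proof.
case: c c' => [x v] [x' v'] /= -> xx'.
have [xm x'm vm] : [/\ x < m, x' < m & v < d * B] by rewrite !ltn_ord.
have nx : x != x' :> nat by clear -xx'; lia.
have [||||l [szl on leg [e1 e2 e3 _]]] := @open_gap x x' v x xm x'm nx vm; try (clear -xx'; lia).
set y := (d.+1 * _)%N in e1 e2; set h := gap_column v in on e1 e2 e3 *.
have hm : h.+1 < m by apply: gap_column_ltn.
have ym : y < m by apply: leq_ltn_trans (ltnW hm); rewrite /h gap_columnE leq_addr.
have above (z : 'I_m) : effect l (embed (z, v)) = at_cell z h.+1.
  by rewrite e3 //= inordK.
have ball_ (a b : nat) : (a == x) || (a == x') -> (b == h) || (b == h.+1) -> at_cell a b \in ball x h.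
  move=> ha hb; rewrite at_cell_ball; clear -ha hb xx' xm x'm hm; lia.
have [] := @conjugate_swap _ _ cell_adjC (ball x h) empty_columns l
  (at_cell x h.+1) (at_cell x' h.+1) (at_cell x h) (at_cell x' h)
  (embed (x, v)) (embed (x', v)) (at_cell x y) (at_cell x' y) leg on;
  rewrite ?above ?e1 ?e2 ?embed_notin_empty_columns ?at_cell_empty_columns ?(inj_eq embed_inj) ?ball_ ?eqxx ?orbT //.
- by rewrite xpair_eqE negb_and nx.
- by rewrite at_cell_eq // negb_and nx.
- rewrite at_cell_adj //; clear -hm; lia.
- rewrite at_cell_adj //; clear -hm xx'; lia.
- rewrite at_cell_adj //; clear -hm xx'; lia.
- rewrite at_cell_adj //; clear -hm xx'; lia.
move=> l' [sz' on' leg' eff'].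
apply: finish_swap on' leg' eff' _ _; rewrite ?at_cell_empty_columns //.
rewrite sz' szl /swap_time; have := ltn_pmod v d_gt0; clear; lia.
Qed.

(** With holes in the gap column of the row and of a neighbouring one, the two
    pieces are on both sides of the gap. Gathering them fills the gap in their row
    and leaves two empty cells next to them in the other row. *)
Lemma horizontal_swap (c c' : V) : c'.1 = c.1 -> c'.2 = c.2.+1 :> nat ->
  exists l, [/\ size l = swap_time, all (perm_on (ball c.1 (gap_column c'.2))) l,
     legal (@cell_adj m) empty_columns l &
     forall e, effect l (embed e) = embed (tperm c c' e)].
Proof.
case: c c' => [x w] [x' v] /= -> vw.
pose z := if x.+1 < m then x.+1 else x.-1.
have zx : (z == x.+1) || (z.+1 == x).
  by rewrite /z; case: (ltnP x.+1 m) => [|h]; [rewrite eqxx | rewrite prednK ?eqxx ?orbT //; have := side_gt1; clear -h; lia].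
have zm : z < m by rewrite /z; case: ifP => // _; apply: leq_ltn_trans (leq_pred x) (ltn_ord x).
clearbody z.
have [xm wm vm] : [/\ x < m, w < d * B & v < d * B] by rewrite !ltn_ord.
have nx : x != z :> nat by clear -zx; lia.
have [||||l [szl on leg [e1 e2 e3 e4]]] := @open_gap x z v x xm zm nx vm; try (clear -zx; lia).
set y := (d.+1 * _)%N in e1 e2; set h := gap_column v in on e1 e2 e3 e4 *.
have hm : h.+1 < m by apply: gap_column_ltn.
have ym : y < m by apply: leq_ltn_trans (ltnW hm); rewrite /h gap_columnE leq_addr.
have h0 : 0 < h by rewrite /h /gap_column vw.
have [k kh] : exists k, h = k.+1 by exists h.-1; rewrite prednK.
rewrite kh in hm on e1 e2 e3 e4 *.
have km : k < m by clear -hm; lia.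
have km1 : k.+1 < m by clear -hm; lia.
have ball_ (a b : nat) : (a == x) || (a == z) -> (b == k) || (b == k.+1) || (b == k.+2) ->
    at_cell a b \in ball x k.+1.
  move=> ha hb; rewrite at_cell_ball; clear -ha hb zx xm zm hm; lia.
have im (r : seq {perm C}) a : (effect r a \in effect r @: empty_columns) = (a \in empty_columns).
  by rewrite mem_perm_imset permK.
have ev : effect l (embed (x, v)) = at_cell x k.+2.
  by rewrite /embed /= -/h kh e3 //= inordK.
have ew : effect l (embed (x, w)) = at_cell x k by rewrite /embed /= e4.
have [] := @rectangle_gather _ (@cell_adj m) cell_adjC (ball x k.+1) (effect l @: empty_columns)
  (at_cell x k) (at_cell x k.+1) (at_cell x k.+2)
  (at_cell z k) (at_cell z k.+1) (at_cell z k.+2);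
  rewrite ?ball_ ?eqxx ?orbT //.
- rewrite at_cell_adj //; clear; lia.
- rewrite at_cell_adj //; clear; lia.
- rewrite at_cell_adj //; clear -zx; lia.
- rewrite at_cell_adj //; clear; lia.
- rewrite /= !inE !at_cell_eq // (negPf nx) !eqxx; clear; lia.
- by rewrite -e1 im at_cell_empty_columns.
- by rewrite -e2 im at_cell_empty_columns.
move=> l2 [szl2 on2 leg2 [f1 f2 f3 f4]].
have [] := @conjugate_swap _ _ cell_adjC (ball x k.+1) empty_columns (l ++ l2)
  (at_cell x k) (at_cell x k.+1) (at_cell z k) (at_cell z k.+1)
  (embed (x, w)) (embed (x, v)) (at_cell z y) (at_cell x y);
  rewrite ?effect_cat ?permM ?ev ?ew ?e1 ?e2 ?f1 ?f2 ?f3 ?f4 ?embed_notin_empty_columns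
    ?at_cell_empty_columns ?(inj_eq embed_inj) ?ball_ ?eqxx ?orbT //.
- by rewrite legal_cat leg leg2.
- by rewrite all_cat on on2.
- by apply/eqP => -[e]; move: vw; rewrite e; clear; lia.
- by rewrite at_cell_eq // negb_and eq_sym nx.
- rewrite at_cell_adj //; clear -zx; lia.
- rewrite at_cell_adj //; clear; lia.
- rewrite at_cell_adj //; clear; lia.
- rewrite at_cell_adj //; clear -zx; lia.
move=> l' [sz' on' leg' eff'].
apply: finish_swap on' leg' eff' _ _; rewrite ?at_cell_empty_columns //.
rewrite sz' size_cat szl szl2 /swap_time; have := ltn_pmod v d_gt0; clear; lia.
Qed.

Definition simulates n (s : {perm V}) := exists l, [/\ size l = n,
  legal (@cell_adj m) empty_columns l & forall c, effect l (embed c) = embed (s c)].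

(** The predicate [P] selects one cell from each pair that [r] exchanges, so that
    the work area [A] and the program are chosen once for each pair. *)
Lemma simulates_matching (r : {perm V}) (P : pred V) (A : V -> {set C}) :
  involutive r ->
  (forall c, r c != c -> P c || P (r c)) ->
  (forall c, P c -> r c != c /\ exists l, [/\ size l = swap_time,
     all (perm_on (A c)) l, legal (@cell_adj m) empty_columns l &
     forall e, effect l (embed e) = embed (tperm c (r c) e)]) ->
  (forall c c', P c -> P c' -> c != c' -> [disjoint A c & A c']) ->
  simulates swap_time r.
Proof.
move=> rK cover hP dA.
have hL c : exists l, P c -> [/\ size l = swap_time,
     all (perm_on (A c)) l, legal (@cell_adj m) empty_columns l &
     forall e, effect l (embed e) = embed (tperm c (r c) e)].
  case: (boolP (P c)) => [/hP[_ [l hl]]|_]; first by exists l.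
  by exists [::].
have {hL}[L hL] := fin_all_exists hL.
have [i Pi|l [sz leg inA outA]] := @legal_parallel _ (@cell_adj m) _ P A L empty_columns swap_time _ dA.
  by have [] := hL i Pi.
(* A program that moves a piece has that piece in its work area. *)
have busy c : r c != c -> exists2 j, P j & (embed c \in A j) && ((j == c) || (j == r c)).
  move=> nrc; have [j Pj jc] : exists2 j, P j & (j == c) || (j == r c).
    by case/orP: (cover c nrc); [exists c | exists (r c)]; rewrite ?eqxx ?orbT.
  exists j; rewrite // jc andbT; apply: contraT => nA.
  have [_ onj _ effj] := hL j Pj.
  have := out_perm (effect_perm_on onj) nA; rewrite effj => /embed_inj.
  case/orP: jc => /eqP ->; rewrite ?rK ?tpermL ?tpermR => e.
    by rewrite e eqxx in nrc.
  by rewrite e eqxx in nrc.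
exists l; split=> // c.
have [i /andP[Pi ci]|none] := pickP [pred i | P i & embed c \in A i].
  rewrite (inA i) //; have [_ _ _ ->] := hL i Pi; congr embed.
  case: tpermP => [->|->|ni nri] //.
  apply/esym/eqP/negPn/negP => /busy[j Pj /andP[cj jc]].
  have nij : i != j.
    by case/orP: jc => /eqP ->; apply/eqP => e; [apply: ni|apply: nri; rewrite e rK].
  by rewrite (disjointFr (dA i j Pi Pj nij) ci) in cj.
rewrite outA => [|i Pi]; last by have := none i; rewrite /= Pi => /negbT.
congr embed; apply/esym/eqP/negPn/negP => /busy[j Pj /andP[cj _]].
by have := none j; rewrite /= Pj cj.
Qed.

End Comb.

(** * Routing configurations *)

Lemma mod_far M a b : a %% M = b %% M -> a != b -> (a + M <= b) || (b + M <= a).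
Proof.
have aux x y : x %% M = y %% M -> x < y -> x + M <= y.
  move=> e lt_xy; have : M %| y - x by rewrite -eqn_mod_dvd ?e // ltnW.
  by move=> /dvdn_leq; rewrite subn_gt0 => /(_ lt_xy); rewrite leq_subRL // ltnW.
move=> e; case: (ltngtP a b) => // h _; first by rewrite aux.
by rewrite (aux b a) ?orbT.
Qed.

Lemma exists_subset_card (T : finType) (S : {set T}) k : k <= #|S| ->
  exists2 H : {set T}, H \subset S & #|H| = k.
Proof.
move=> hk; exists [set x in take k (enum S)].
  by apply/subsetP => x; rewrite inE => /mem_take; rewrite mem_enum.
rewrite cardsE (card_uniqP _) ?take_uniq ?enum_uniq // size_take -cardE.
by case: ltngtP hk.
Qed.

Lemma consecutive_ltn L (i j : 'I_L) : consecutive i j -> i < j -> j = i.+1 :> nat.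
Proof. by rewrite /consecutive => /orP[/eqP//|/eqP <-]; move: (j : nat); lia. Qed.

Lemma consecutive_total L (i j : 'I_L) : consecutive i j -> (i < j) || (j < i).
Proof. by rewrite /consecutive => /orP[/eqP <-|/eqP <-]; rewrite ltnSn ?orbT. Qed.

Section Simulation.
Local Open Scope group_scope.
Variables (m' d B : nat).
Local Notation m := m'.+1.
Hypothesis d_gt0 : 0 < d.
Hypothesis mE : m = (d.+1 * B)%N.
Local Notation V := ('I_m * 'I_(d * B))%type.
Local Notation C := ('I_m * 'I_m)%type.
Local Notation empty_columns := (empty_columns m' d).
Local Notation embed := (@embed m' d B).
Local Notation legal := (legal (@cell_adj m)).
Local Notation simulates := (@simulates m' d B).
Implicit Types (c : V) (A H : {set C}).

Lemma disjoint_balls x y x' y' :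
  [|| x + 3 <= x', x' + 3 <= x, y + (2 * d + 3) <= y' | y' + (2 * d + 3) <= y]%N ->
  [disjoint ball m' d x y & ball m' d x' y'].
Proof.
move=> far; rewrite disjoint_subset; apply/subsetP => a; rewrite !inE.
move: (a.1 : nat) (a.2 : nat) far => a1 a2; clear; lia.
Qed.

(** Distinct places of one class are at least [2 * d + 3] apart in one of the two
    coordinates, which exceeds the diameter of the balls. *)
Lemma disjoint_work_areas k c c' :
  c.1 %% (2 * d + 3) = c'.1 %% (2 * d + 3) ->
  c.2 %% (2 * d + 3) = c'.2 %% (2 * d + 3) -> c != c' ->
  [disjoint ball m' d c.1 (gap_column d (c.2 + k))
          & ball m' d c'.1 (gap_column d (c'.2 + k))].
Proof.
move=> c1 c2 ncc'; apply: disjoint_balls.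
have M3 : 3 <= 2 * d + 3 by rewrite leq_addl.
have [e1|n1] := eqVneq (c.1 : nat) c'.1; last first.
  case/orP: (mod_far c1 n1) => h; apply/or4P; [apply: Or41|apply: Or42];
    by apply: leq_trans h; rewrite leq_add2l.
have n2 : c.2 != c'.2 :> nat.
  apply: contra ncc' => /eqP e2; apply/eqP.
  by case: (c) (c') e1 e2 => [? ?] [? ?] /= /ord_inj-> /ord_inj->.
have gap v w : v + (2 * d + 3) <= w ->
    gap_column d (v + k) + (2 * d + 3) <= gap_column d (w + k).
  move=> h; have vw : v + k <= w + k by rewrite leq_add2r (leq_trans (leq_addr _ _) h).
  by have := gap_column_leq d vw; move: h; clear; lia.
by case/orP: (mod_far c2 n2) => /gap h; apply/or4P; [apply: Or43|apply: Or44].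
Qed.

Lemma simulates_round (r : {perm V}) : grid_round (2 * d + 3)%N r ->
  simulates (swap_time d) r.
Proof.
move=> [rK [e [z [] hr]]].
- have up c : c.1 < (r c).1 -> [/\ (r c).2 = c.2, (r c).1 = c.1.+1 :> nat,
      c.1 %% (2 * d + 3) = e & c.2 %% (2 * d + 3) = z].
    move=> lt_c; have [rc|[e2 cons me mz]] := hr c; first by rewrite rc ltnn in lt_c.
    by rewrite -me (minn_idPl (ltnW lt_c)) (consecutive_ltn cons lt_c).
  apply: (simulates_matching d_gt0 mE (P := fun c => c.1 < (r c).1)
    (A := fun c => ball m' d c.1 (gap_column d c.2))) => // [c nrc|c Pc|c c' Pc Pc'].
  + have [/eqP|[_ cons _ _]] := hr c; first by rewrite (negPf nrc).
    by rewrite rK; apply: consecutive_total.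
  + have [e2 e1 _ _] := up c Pc; split; last exact: vertical_swap.
    by apply: contraTneq Pc => ->; rewrite ltnn.
  have [_ _ c1 c2] := up c Pc; have [_ _ c1' c2'] := up c' Pc'.
  by have := @disjoint_work_areas 0 c c'; rewrite !addn0 c1 c2 c1' c2'; apply.
- have up c : c.2 < (r c).2 -> [/\ (r c).1 = c.1, (r c).2 = c.2.+1 :> nat,
      c.2 %% (2 * d + 3) = e & c.1 %% (2 * d + 3) = z].
    move=> lt_c; have [rc|[e2 cons me mz]] := hr c; first by rewrite rc ltnn in lt_c.
    by rewrite -me (minn_idPl (ltnW lt_c)) (consecutive_ltn cons lt_c).
  apply: (simulates_matching d_gt0 mE (P := fun c => c.2 < (r c).2)
    (A := fun c => ball m' d c.1 (gap_column d (r c).2))) => // [c nrc|c Pc|c c' Pc Pc'].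
  + have [/eqP|[_ cons _ _]] := hr c; first by rewrite (negPf nrc).
    by rewrite rK; apply: consecutive_total.
  + have [e2 e1 _ _] := up c Pc; split; last exact: horizontal_swap.
    by apply: contraTneq Pc => ->; rewrite ltnn.
  have [_ v1 c1 c2] := up c Pc; have [_ v1' c1' c2'] := up c' Pc'.
  rewrite v1 v1'; have := @disjoint_work_areas 1 c c'.
  by rewrite !addn1 c1 c2 c1' c2'; apply.
Qed.

Lemma effect_empty_columns (g s : {perm _}) : (forall c, g (embed c) = embed (s c)) ->
  g @: empty_columns = empty_columns.
Proof.
move=> gs; apply/setP => a; rewrite mem_perm_imset; apply/idP/idP.
  apply: contraTT => /(notin_empty_columnsP d_gt0 mE)[c ->].
  by rewrite -[c](permKV s) -gs permK embed_notin_empty_columns.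
apply: contraTT => /(notin_empty_columnsP d_gt0 mE)[c ec].
by rewrite -[a](permKV g) ec gs embed_notin_empty_columns.
Qed.

Lemma simulates_routed n s : routed (2 * d + 3)%N n s -> simulates (n * swap_time d)%N s.
Proof.
move=> [l [<- hl ->]]; elim: l hl => [|r l IH] hl.
  by exists [::]; split=> // c; rewrite effect_nil big_nil !perm1.
have [|l1 [sz1 leg1 e1]] := @simulates_round r; first by apply: hl; rewrite inE eqxx.
have [|l2 [sz2 leg2 e2]] := IH; first by move=> r' h; apply: hl; rewrite inE h orbT.
exists (l1 ++ l2); split=> [||c].
- by rewrite size_cat sz1 sz2.
- by rewrite legal_cat leg1 (effect_empty_columns e1).
- by rewrite effect_cat big_cons !permM e1 e2.
Qed.

Lemma rearrange_holes n (s : {perm C}) H : routed 2 n s ->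
  exists l, [/\ size l = n, legal H l & effect l @: H = s @: H].
Proof.
move=> [l [<- hl ->]]; elim: l H hl => [|r l IH] H hl.
  by exists [::]; split=> //; rewrite effect_nil big_nil.
have [rK [e [z hr]]] : grid_round 2 r by apply: hl; rewrite inE eqxx.
have [|r' [sl' im']] := @slide_matching _ (@cell_adj m) H r rK.
  move=> c; rewrite /cell_adj; case: hr => /(_ c) [->|[-> h _ _]]; [by left| | by left|];
    by right; rewrite eqxx h ?orbT.
have [|l' [sz leg im]] := IH (r' @: H); first by move=> r2 h; apply: hl; rewrite inE h orbT.
exists (r' :: l'); split=> /=.
- by rewrite sz.
- by rewrite sl' leg.
- by rewrite effect_cons big_cons !imsetM im im'.
Qed.

(** The two rearrangements of holes use [grid_routing] with modulus [2] and take
    [24 * m] steps each; the permutation in between takes at most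
    [6 * M ^ 2 * m] rounds with [M = 2 * d + 3], each of them simulated in time
    [swap_time d]. *)
Definition routing_time := (48 + 6 * (2 * d + 3) ^ 2 * swap_time d)%N.

Lemma route_pieces (I : finType) (u v : I -> C) H H' :
  #|H| = #|empty_columns| -> #|H'| = #|empty_columns| -> injective u -> injective v ->
  (forall i, u i \notin H) -> (forall i, v i \notin H') ->
  exists l, [/\ size l <= routing_time * m, legal H l &
    forall i, effect l (u i) = v i].
Proof.
have to_empty_columns (K : {set C}) : #|K| = #|empty_columns| -> exists l, [/\ size l = (m * 24)%N, legal K l & effect l @: K = empty_columns].
  move=> /perm_card_eq[s sK].
  have [l [sz leg im]] := rearrange_holes K (grid_routing (isT : 1 < 2) s).
  by exists l; rewrite im sK sz; split=> //; clear; lia.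
move=> /to_empty_columns[l1 [sz1 leg1 im1]] /to_empty_columns[l3 [sz3 leg3 im3]] u_inj v_inj uH vH.
have avoid (l : seq {perm C}) (K : {set C}) (w : I -> C) : effect l @: K = empty_columns -> (forall i, w i \notin K) ->
    injective w -> exists a : I -> V, injective a /\ forall i, effect l (w i) = embed (a i).
  move=> im wK w_inj.
  have ex i : exists c, effect l (w i) = embed c.
    apply: (notin_empty_columnsP d_gt0 mE); rewrite -im mem_perm_imset permK; exact: wK.
  have [a ha] := fin_all_exists ex; exists a; split=> // i j eij.
  by apply/w_inj/(@perm_inj _ (effect l)); rewrite !ha eij.
have [a [a_inj ha]] := avoid _ _ _ im1 uH u_inj.
have [b [b_inj hb]] := avoid _ _ _ im3 vH v_inj.
have [s hs] := perm_extend a_inj b_inj.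
have M1 : 1 < 2 * d + 3 by clear; lia.
have [l2 [sz2 leg2 e2]] := simulates_routed (grid_routing M1 s).
have [leg3' e3'] := legal_rev (@cell_adjC m') leg3.
exists (l1 ++ l2 ++ rev (map invg l3)); split.
- rewrite !size_cat size_rev size_map sz1 sz2 sz3 /routing_time.
  have : d * B <= m by rewrite mE leq_mul2r leqnSn orbT.
  move: (d * B)%N (swap_time d) (2 * d + 3)%N => w t M; clear; nia.
- by rewrite !legal_cat leg1 im1 leg2 (effect_empty_columns e2) -im3.
- by move=> i; rewrite !effect_cat !permM ha e2 hs e3' -hb permK.
Qed.

Lemma card_empty_columns : #|empty_columns| + m * (d * B) = (m * m)%N.
Proof.
have <- : #|~: empty_columns| = (m * (d * B))%N.
  have <- : embed @: setT = ~: empty_columns.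
    apply/setP => a; rewrite in_setC; apply/imsetP/idP => [[c _ ->]|].
      exact: embed_notin_empty_columns.
    by move=> /(notin_empty_columnsP d_gt0 mE)[c ->]; exists c.
  by rewrite card_imset ?cardsT ?card_prod ?card_ord //; apply: embed_inj.
by rewrite cardsC card_prod card_ord.
Qed.

End Simulation.

Section Configurations.
Local Open Scope group_scope.
Variables (n m : nat).
Local Notation C := ('I_m * 'I_m)%type.
Implicit Types (f g : sq n m) (H : {set C}).

Lemma pos_inj f : injective (pos f).
Proof. exact/injectiveP/(valP f). Qed.

Lemma config_eq f g : (forall i, pos f i = pos g i) -> f = g.
Proof. by move=> e; apply/val_inj/ffunP. Qed.

Lemma config_exists (u : 'I_n -> C) : injective u -> exists f, forall i, pos f i = u i.
Proof.
move=> u_inj; have h : injectiveb [ffun i => u i].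
  by apply/injectiveP => i j; rewrite !ffunE => /u_inj.
by exists (exist (fun f : {ffun 'I_n -> C} => injectiveb f) _ h) => i; rewrite /pos /= ffunE.
Qed.

Lemma legal_path l H f : legal (@cell_adj m) H l -> (forall i, pos f i \notin H) ->
  exists p : seq (sq n m), [/\ path (@sq_move n m) f p, size p = size l &
    forall i, pos (last f p) i = effect l (pos f i)].
Proof.
elim: l H f => [|r l IH] H f /=.
  by move=> _ _; exists [::]; split=> // i; rewrite effect_nil perm1.
move=> /andP[/slideP hr leg] fH.
have [g gE] := config_exists (inj_comp (@perm_inj _ r) (@pos_inj f)).
have [|p [hp sz last_p]] := IH _ g leg.
  by move=> i; rewrite gE mem_perm_imset permK.
exists (g :: p); split=> /=; last by move=> i; rewrite last_p gE effect_cons permM.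
  rewrite hp andbT; apply/forallP => i; rewrite gE /=.
  have [->|[adj_r rH]] := hr _ (fH i); first by rewrite eqxx.
  rewrite adj_r; apply/orP; right; apply/forallP => j.
  by apply: contraNneq (fH j) => ->.
by rewrite sz.
Qed.

(** Only as many holes as needed are kept in [H]; the remaining ones are then
    treated as if they were pieces. *)
Lemma occupied_subset f k : k + n <= m * m ->
  exists H, #|H| = k /\ forall i, pos f i \notin H.
Proof.
move=> hk; pose S := [set pos f i | i : 'I_n].
have [|H HS cardH] := @exists_subset_card _ (~: S) k.
  have := cardsC S; rewrite card_imset ?card_ord ?card_prod ?card_ord; last exact: pos_inj.
  by move: hk; clear; lia.
exists H; split=> // i; apply/negP => /(subsetP HS); rewrite in_setC => /imsetP[].
by exists i.
Qed.
End Configurations.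

Theorem config_route d B n m (f g : sq n m) :
  0 < d -> 0 < m -> m = (d.+1 * B)%N -> n <= m * (d * B) ->
  exists p, [/\ path (@sq_move n m) f p, last f p = g & size p <= routing_time d * m]%N.
Proof.
case: m f g => // m' f g d_gt0 _ mE hn.
have hk : #|empty_columns m' d| + n <= m'.+1 * m'.+1 by rewrite -(card_empty_columns d_gt0 mE) leq_add2l.
have [H [cH fH]] := occupied_subset f hk.
have [H' [cH' gH]] := occupied_subset g hk.
have [l [sz leg eff]] := route_pieces d_gt0 mE cH cH' (@pos_inj _ _ f) (@pos_inj _ _ g) fH gH.
have [p [hp szp lastp]] := legal_path leg fH.
exists p; split=> //; last by rewrite szp.
by apply: config_eq => i; rewrite lastp eff.
Qed.

(** * Distances and diameters *)

Import Order.TTheory GRing.Theory Num.Theory.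
Local Open Scope ring_scope.

Section Distances.
Variable R : realType.
Local Open Scope ereal_scope.

Lemma graph_dist_le (T : eqType) (e : rel T) x y p : path e x p -> last x p = y ->
  graph_dist R e x y <= ((size p)%:R)%:E.
Proof.
move=> hp hl; apply: ereal_inf_lbound; exists p => //=.
by rewrite hp hl eqxx.
Qed.

Lemma graph_dist_ge (T : eqType) (e : rel T) x y k :
  (forall p, path e x p -> last x p = y -> (k <= size p)%N) ->
  (k%:R)%:E <= graph_dist R e x y.
Proof.
move=> h; apply: le_ereal_inf_tmp => _ [p /= /andP[hp /eqP hl] <-].
by rewrite lee_fin ler_nat h.
Qed.

Lemma diameter_le (T : Type) (d : T -> T -> \bar R) K :
  (forall x y, d x y <= K) -> diameter d <= K.
Proof. by move=> h; apply: ge_ereal_sup => _ [[x y] _ <-]. Qed.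

Lemma diameter_ge (T : Type) (d : T -> T -> \bar R) x y K :
  K <= d x y -> K <= diameter d.
Proof.
move=> h; apply: le_trans h _; apply: ereal_sup_ubound.
by exists (x, y).
Qed.
End Distances.

Section GridDistances.
Local Open Scope nat_scope.
Variables (n m : nat).
Local Notation C := ('I_m * 'I_m)%type.

(** The path shortens the Manhattan distance [D] by one at each step. *)
Lemma cell_path (a b : C) : exists p, [/\ path (@cell_adj m) a p, last a p = b & size p <= 2 * m].
Proof.
pose D (a b : C) := (a.1 - b.1) + (b.1 - a.1) + (a.2 - b.2) + (b.2 - a.2).
suff [p [hp hl sz]] : exists p, [/\ path (@cell_adj m) a p, last a p = b & size p = D a b].
  exists p; split=> //; rewrite sz /D.
  move: (ltn_ord a.1) (ltn_ord a.2) (ltn_ord b.1) (ltn_ord b.2); clear.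
  by move: (a.1 : nat) (a.2 : nat) (b.1 : nat) (b.2 : nat); lia.
have [k Dk] : exists k, D a b = k by exists (D a b).
elim: k a Dk => [|k IH] [i j] Dk.
  exists [::]; split=> //=; case: b Dk => i' j'; rewrite /D /= => Dk.
  by congr (_, _); apply: ord_inj; move: Dk; clear; lia.
have step a' : cell_adj (i, j) a' -> D a' b = k ->
    exists p, [/\ path (@cell_adj m) (i, j) p, last (i, j) p = b & size p = D (i, j) b].
  move=> ad Dk'; have [p [hp hl sz]] := IH a' Dk'.
  by exists (a' :: p); rewrite /= ad sz Dk Dk'.
case: b @D Dk step {IH} => i' j' D Dk step.
have [li|gi|ei] := ltngtP i i'.
- have h : i.+1 < m := leq_ltn_trans li (ltn_ord i').
  apply: (step (Ordinal h, j)); first by rewrite /cell_adj /consecutive /= !eqxx orbT.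
  by move: Dk li; rewrite /D /=; clear; lia.
- have h : i.-1 < m := leq_ltn_trans (leq_pred i) (ltn_ord i).
  apply: (step (Ordinal h, j)).
    by rewrite /cell_adj /consecutive /= (prednK (leq_ltn_trans (leq0n _) gi)) !eqxx !orbT.
  by move: Dk gi; rewrite /D /=; clear; lia.
have [lj|gj|ej] := ltngtP j j'.
- have h : j.+1 < m := leq_ltn_trans lj (ltn_ord j').
  apply: (step (i, Ordinal h)); first by rewrite /cell_adj /consecutive /= !eqxx.
  by move: Dk lj; rewrite /D /=; clear; lia.
- have h : j.-1 < m := leq_ltn_trans (leq_pred j) (ltn_ord j).
  apply: (step (i, Ordinal h)).
    by rewrite /cell_adj /consecutive /= (prednK (leq_ltn_trans (leq0n _) gj)) !eqxx !orbT.
  by move: Dk gj; rewrite /D /=; clear; lia.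
by move: Dk; rewrite /D /= ei ej; clear; lia.
Qed.

Lemma cell_adj_row (a b : C) : cell_adj a b -> b.1 <= a.1.+1.
Proof.
rewrite /cell_adj /consecutive => /orP[/andP[/eqP -> _]//|/andP[_ /orP[]/eqP <-]] //.
by rewrite ltnW // ltnW.
Qed.

Lemma cell_path_row (a : C) p : path (@cell_adj m) a p ->
  (last a p).1 <= a.1 + size p.
Proof.
elim: p a => [|b p IH] a /=; first by rewrite addn0.
by move=> /andP[/cell_adj_row ab /IH]; move: (last b p) => c; lia.
Qed.

Lemma config_path_row (f : sq n m) p i : path (@sq_move n m) f p ->
  (pos (last f p) i).1 <= (pos f i).1 + size p.
Proof.
elim: p f => [|g p IH] f /=; first by rewrite addn0.
move=> /andP[/forallP/(_ i) fg /IH].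
have : (pos g i).1 <= (pos f i).1.+1.
  by case/orP: fg => [/eqP ->//|/andP[/cell_adj_row]].
by move: (pos (last g p) i) => c; lia.
Qed.

Lemma far_configs : 0 < n -> 0 < m -> n <= m * m ->
  exists (f g : sq n m) i, (pos f i).1 + m.-1 <= (pos g i).1.
Proof.
move=> n0 m0 hn; have hn' : n <= #|{: C}| by rewrite card_prod card_ord.
pose u (i : 'I_n) : C := enum_val (widen_ord hn' i).
have u_inj : injective u by move=> i j /enum_val_inj /(congr1 val) /= /ord_inj.
pose i0 := Ordinal n0.
have place c : exists f : sq n m, pos f i0 = c.
  have [f fE] := config_exists (inj_comp (@perm_inj _ (tperm (u i0) c)) u_inj).
  by exists f; rewrite fE /= tpermL.
have hl : m.-1 < m by rewrite prednK.
have [f fE] := place (Ordinal m0, Ordinal m0).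
have [g gE] := place (Ordinal hl, Ordinal m0).
by exists f, g, i0; rewrite fE gE.
Qed.
End GridDistances.

Section Diameters.
Variable R : realType.
Local Open Scope ereal_scope.

Lemma diameters_ge n m : (0 < n)%N -> (0 < m)%N -> (n <= m * m)%N ->
  (m.-1%:R)%:E <= diameter (@Linfty_intrinsic R n m) /\
  (m.-1%:R)%:E <= diameter (@Linfty_extrinsic R n m).
Proof.
move=> n0 m0 hn; have [f [g [i far]]] := far_configs n0 m0 hn.
split; apply: (@diameter_ge _ _ _ f g).
  apply: graph_dist_ge => p /(config_path_row i) + e; rewrite e => le_p.
  by rewrite -(leq_add2l (pos f i).1) (leq_trans far).
apply: le_trans (le_bigmax _ _ i).
apply: graph_dist_ge => p /cell_path_row + e; rewrite e => le_p.
by rewrite -(leq_add2l (pos f i).1) (leq_trans far).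
Qed.

Lemma extrinsic_diameter_le n m :
  diameter (@Linfty_extrinsic R n m) <= ((2 * m)%:R)%:E.
Proof.
apply: diameter_le => f g; apply: bigmax_le => [|i _]; first by rewrite lee_fin.
have [p [hp hl sz]] := cell_path (pos f i) (pos g i).
by apply: le_trans (graph_dist_le _ hp hl) _; rewrite lee_fin ler_nat.
Qed.

Lemma intrinsic_diameter_le d B n m :
  (0 < d)%N -> (0 < m)%N -> m = (d.+1 * B)%N -> (n <= m * (d * B))%N ->
  diameter (@Linfty_intrinsic R n m) <= ((routing_time d * m)%:R)%:E.
Proof.
move=> d0 m0 mE hn; apply: diameter_le => f g.
have [p [hp hl sz]] := config_route f g d0 m0 mE hn.
by apply: le_trans (graph_dist_le _ hp hl) _; rewrite lee_fin ler_nat.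
Qed.
End Diameters.

Theorem theorem2 (R : realType) (alpha : R) (alpha_gt0 : 0 < alpha)
    (alpha_lt1 : alpha < 1) :
  exists (c C : R) (m0 : nat), [/\ 0 < c, 0 < C &
    forall m n : nat,
      (m0 <= m)%N ->
      (exists k : nat, m = (2 ^ k)%N) ->
      alpha / 2 * m%:R ^+ 2 < n%:R ->
      n%:R <= alpha * m%:R ^+ 2 ->
      ((c * m%:R)%:E <= diameter (@Linfty_intrinsic R n m) <= (C * m%:R)%:E)%E /\
      ((c * m%:R)%:E <= diameter (@Linfty_extrinsic R n m) <= (C * m%:R)%:E)%E].
Proof.
have gap : 0 < 1 - alpha by rewrite subr_gt0.
have [s s0 hs] : exists2 s, (0 < s)%N & 1 <= (1 - alpha) * (2 ^ s)%:R.
  (* One empty column out of [2 ^ s] takes at most a proportion [1 - alpha] of the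
     cells. *)
  pose b := Num.Def.archi_bound (1 - alpha)^-1; exists b.+1 => //.
  rewrite mulrC -ler_pdivrMr // mul1r.
  apply: le_trans (ltW (archi_boundP _)) _; first by rewrite invr_ge0 ltW.
  by rewrite ler_nat ltnW // (leq_trans (ltnSn _)) // ltnW // ltn_expl.
pose d := (2 ^ s).-1.
have dE : d.+1 = (2 ^ s)%N by rewrite prednK ?expn_gt0.
have d0 : (0 < d)%N by rewrite -ltnS dE -{1}(expn0 2) ltn_exp2l.
exists (1 / 2), (routing_time d)%:R, (2 ^ s)%N; split; [by rewrite divr_gt0 | by rewrite ltr0n |].
move=> m n hm [k mk] lo up.
have m1 : (1 < m)%N by apply: leq_trans hm; rewrite -dE.
have sk : (s <= k)%N by rewrite -(@leq_exp2l 2) // -mk.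
pose B := (2 ^ (k - s))%N.
have mE : m = (d.+1 * B)%N by rewrite dE -expnD subnKC.
have mR : 0 < m%:R :> R by rewrite ltr0n ltnW.
have n0 : (0 < n)%N.
  rewrite -(ltr0n R); apply: le_lt_trans lo.
  by rewrite mulr_ge0 ?exprn_ge0 ?divr_ge0 ?ltW.
have hn : (n <= m * (d * B))%N.
  rewrite -(ler_nat R); apply: le_trans up _.
  have hB : (m * (d * B))%:R = m%:R ^+ 2 - m%:R * B%:R :> R.
    rewrite expr2 -mulrBr natrM; congr (_ * _); rewrite [in RHS]mE.
    by rewrite mulSn natrD [X in X - _]addrC addrK.
  rewrite hB lerBrDr -lerBrDl -{1}[m%:R ^+ 2]mul1r -mulrBl expr2.
  rewrite mulrCA ler_pM2l // [in leRHS]mE natrM mulrA dE.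
  by rewrite -{1}[B%:R]mul1r ler_wpM2r.
have hnm : (n <= m * m)%N.
  by apply: leq_trans hn _; rewrite leq_mul2l {2}mE leq_mul2r leqnSn !orbT.
have [lb1 lb2] := diameters_ge R n0 (ltnW m1) hnm.
have half : ((1 / 2 * m%:R)%:E <= (m.-1%:R)%:E :> \bar R)%E.
  rewrite lee_fin mul1r mulrC ler_pdivrMr // -natrM ler_nat.
  by move: m1; clear; lia.
split; apply/andP; split.
- exact: le_trans lb1.
- by rewrite -natrM; apply: (intrinsic_diameter_le R d0 (ltnW m1) mE hn).
- exact: le_trans lb2.
apply: le_trans (extrinsic_diameter_le R n m) _.
by rewrite lee_fin -natrM ler_nat leq_mul2r orbC.
Qed.
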